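(* Let $K:\mathbb{S}^2\times\mathbb{S}^2\to\mathbb{R}$ be an interaction kernel such that (a) $K$ is continuous in both variables; (b) $K(p,q)=K(q,p)$ for all $p,q\in\mathbb{S}^2$; (c) $K(p,q)=K(Rq,Rp)$ for all $p,q\in\mathbb{S}^2$ and all $R\in SO(3)$; so that $K(p,q)=k(p\cdot q)$ for a function $k$ of one real variable. Assume that $K$ admits a Taylor expansion such that $K(p,q)=\sum_{r=0}^\infty a_r(p\cdot q)^r$ converges for all $p,q\in\mathbb{S}^2$ with $|p\cdot q|<1$, and that the $a_r$ satisfy $$\sum_{l=0}^\infty\ \sum_{r=l,l+2,l+4,\dots}\left|\frac{4\pi(4l+1)^{3/2}a_r\,r!}{2^{(r-l)/2}\left(\frac12(r-l)\right)!\,(l+r+1)!!}\right|<\infty .$$ Then the eigenfunctions of the interaction operator $$U\eta(p)=\int_{\mathbb{S}^2}k(p\cdot q)\eta(q)\,dq$$ are given by the spherical harmonics $Y_l^m:\mathbb{S}^2\to\mathbb{C}$, and the corresponding eigenvalues are $$\mu_s=\sum_{r=0}^\infty\frac{4\pi\,a_{s+2r}\,(s+2r)!}{2^r\,r!\,(2s+2r+1)!!},\qquad s\in\mathbb{N},$$ i.e. $UY_s^n=\mu_sY_s^n$ for all $s\in\mathbb{N}$ and $-s\le n\le s$.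
   Context: $\mathbb{S}^2\subset\mathbb{R}^3$ is the unit sphere with surface measure $dq$. $\mathbb{N}=\{0,1,2,\dots\}$. $n!!$ is the double factorial. In spherical coordinates ($\varphi\in[0,2\pi)$ the angle around the $z$-axis, $\theta\in[0,\pi)$ the angle from the $z$-axis) the spherical harmonics of degree $l\ge0$ and order $-l\le m\le l$ are $Y_l^m(\varphi,\theta)=N_{lm}e^{im\varphi}P_l^m(\cos\theta)$ with $N_{lm}=(-1)^m\left(\frac{2l+1}{4\pi}\right)^{1/2}\left(\frac{(l-m)!}{(l+m)!}\right)^{1/2}$ and $P_l^m(\mu)=\frac{1}{2^ll!}(1-\mu^2)^{m/2}\frac{d^{l+m}}{d\mu^{l+m}}(\mu^2-1)^l$; they form an orthonormal basis of $L^2(\mathbb{S}^2)$. *)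

(* Defs.v *)
From HB Require Import structures.
From mathcomp Require Import all_boot all_order all_algebra.
From mathcomp Require Import all_classical all_reals all_analysis.
From mathcomp Require Import complex.

Set Implicit Arguments.
Unset Strict Implicit.
Unset Printing Implicit Defensive.

Import Order.TTheory GRing.Theory Num.Theory.
Import numFieldNormedType.Exports.

Local Open Scope classical_set_scope.
Local Open Scope ring_scope.

Fixpoint double_fact (n : nat) : nat :=
  if n is n'.+2 then (n * double_fact n')%N else 1%N.

Section Sphere.
Context {R : realType}.

Definition dotp (p q : 'cV[R]_3) : R := \sum_i p i ord0 * q i ord0.

(* The library norm on matrices is the max norm, so the Euclidean sphere is
   described with the scalar product. *)
Definition unit_sphere : set 'cV[R]_3 := [set p | dotp p p = 1].

Definition is_SO3 (M : 'M[R]_3) : Prop := M^T *m M = 1%:M /\ \det M = 1.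

Definition coord_x (p : 'cV[R]_3) : R := p (inord 0) ord0.
Definition coord_y (p : 'cV[R]_3) : R := p (inord 1) ord0.
Definition coord_z (p : 'cV[R]_3) : R := p (inord 2) ord0.

Definition sph_point (phi theta : R) : 'cV[R]_3 :=
  \col_(i < 3) [:: sin theta * cos phi; sin theta * sin phi; cos theta]`_i.

(* Inverse coordinates, with polar p in [0, pi] and azimuth p in [0, 2 pi[.
   At the two poles the value of azimuth is arbitrary; the spherical harmonics
   do not depend on it there. *)
Definition polar (p : 'cV[R]_3) : R := acos (coord_z p).

Definition azimuth (p : 'cV[R]_3) : R :=
  let phi := acos (coord_x p / Num.sqrt (coord_x p ^+ 2 + coord_y p ^+ 2)) in
  if 0 <= coord_y p then phi else 2 * pi - phi.

(* dq = sin theta dtheta dphi *)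
Definition sphere_integral (f : 'cV[R]_3 -> R) : R :=
  \int[lebesgue_measure]_(phi in `[0, 2 * pi[)
    \int[lebesgue_measure]_(theta in `[0, pi])
      (f (sph_point phi theta) * sin theta).

Definition sphere_integralC (f : 'cV[R]_3 -> R[i]) : R[i] :=
  Complex (sphere_integral (fun q => complex.Re (f q)))
          (sphere_integral (fun q => complex.Im (f q))).

(* For m < 0 the exponent m / 2 is negative; at mu = 1 and mu = -1 the
   convention 0 `^ x = 0 for x != 0 then yields the value 0, which is the
   continuous extension of the formula.  The order of differentiation l + m
   is natural as long as - l <= m. *)
Definition assoc_legendre (l : nat) (m : int) (mu : R) : R :=
  (2 ^+ l * l`!%:R)^-1 * (1 - mu ^+ 2) `^ (m%:~R / 2)
  * ((('X ^+ 2 - 1) ^+ l)^`(absz (l%:Z + m)) : {poly R}).[mu].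

Definition sph_harm_norm (l : nat) (m : int) : R :=
  (-1) ^ m * Num.sqrt ((2 * l%:R + 1) / (4 * pi))
  * Num.sqrt ((absz (l%:Z - m))`!%:R / (absz (l%:Z + m))`!%:R).

Definition sph_harm_coord (l : nat) (m : int) (phi theta : R) : R[i] :=
  (sph_harm_norm l m)%:C%C
  * Complex (cos (m%:~R * phi)) (sin (m%:~R * phi))
  * (assoc_legendre l m (cos theta))%:C%C.

Definition sph_harm (l : nat) (m : int) (p : 'cV[R]_3) : R[i] :=
  sph_harm_coord l m (azimuth p) (polar p).

Definition interaction_op (k : R -> R) (eta : 'cV[R]_3 -> R[i])
    (p : 'cV[R]_3) : R[i] :=
  sphere_integralC (fun q => (k (dotp p q))%:C%C * eta q).

Definition is_eigenfunction (U : ('cV[R]_3 -> R[i]) -> 'cV[R]_3 -> R[i])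
    (eta : 'cV[R]_3 -> R[i]) (lambda : R) : Prop :=
  (exists2 p, unit_sphere p & eta p != 0)
  /\ (forall p, unit_sphere p -> U eta p = lambda%:C%C * eta p).

Definition mu_term (a : nat -> R) (s r : nat) : R :=
  4 * pi * a (s + 2 * r)%N * (s + 2 * r)`!%:R
  / (2 ^+ r * r`!%:R * (double_fact (2 * s + 2 * r + 1))%:R).

Definition mu_eigen (a : nat -> R) (s : nat) : R :=
  limn (series (mu_term a s)).

(* Used for r >= l with r - l even, so that (r - l)./2 is exactly (r - l) / 2 *)
Definition summability_term (a : nat -> R) (l r : nat) : R :=
  4 * pi * (4 * l%:R + 1) `^ (3 / 2) * a r * r`!%:R
  / (2 ^+ (r - l)./2 * ((r - l)./2)`!%:R * (double_fact (l + r + 1))%:R).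

End Sphere.

(* Main.v *)
Require Import Defs.
From mathcomp Require Import all_boot all_order all_algebra.
From mathcomp Require Import all_classical all_reals all_analysis.
From mathcomp Require Import complex.
From mathcomp Require Import ring lra zify.
Import Order.TTheory GRing.Theory Num.Theory.
Import numFieldNormedType.Exports.
Local Open Scope classical_set_scope.
Local Open Scope ring_scope.

(** Why the theorem holds.  The operator with kernel [(p . q)^r] multiplies
every spherical harmonic of degree [s] by a number [lambda_(r,s)]; the general
kernel is a limit of polynomials in [p . q], and [mu_s] is the limit of the
corresponding combinations of the [lambda_(r,s)].

The numbers [lambda_(r,s)].  Put [xi = x + i y], [eta = x - i y] and write a
linear form as [L = al xi + be eta + ga z], with complex coefficients; its
square length is [|L|^2 = 4 al be + ga^2].  In spherical coordinates the
integral over the azimuth only keeps the monomials with as many factors [xi]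
as [eta], and the remaining integrals over the polar angle satisfy a one-step
recursion.  The binomial sum closes up into
  [int L(q)^N dq = 4 pi (|L|^2)^(N/2) / (N + 1)]  for even [N], and 0 for odd [N]
([sphere_integral_power]).  As complex coefficients are allowed, the identity
can be polarised in a null direction: the form [W_t = t^2 xi + 2 t z - eta] has
[|W_t|^2 = 0], so for a unit vector [p] the form [q |-> p . q + h W_t(q)] has
square length [1 + 2 h W_t(p)].  Comparing the coefficients of [h^s] gives
  [int (p . q)^r W_t(q)^s dq = lambda_(r,s) W_t(p)^s]
([dot_null_moment]), and comparing those of [t^n] gives the same relation for
the coefficient of [t^n] in [W_t^s] ([solid_harmonic_moment]).

These coefficients are the spherical harmonics.  At a point with angles
[phi], [theta] put [u = sin theta e^(i phi) t] and [mu = cos theta]; then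
[(mu + u)^2 - 1 = sin theta e^(i phi) W_t].  The Taylor expansion of
[(mu^2 - 1)^s] at [mu] therefore expands [W_t^s] in powers of [t] with the
derivatives of the Rodrigues formula as coefficients, for negative orders just
as for positive ones ([rodrigues_solid], [sph_harm_solid]).

From polynomials to [k].  The power series of [k] need not converge at the end
points of [-1, 1], so its partial sums cannot be used directly.  For [x < 1]
the dilated series [sum a_r x^r t^r] converges uniformly on [-1, 1] to
[k (x t)], which is uniformly close to [k t] when [x] is close to 1.  On the
side of the eigenvalues, [sum a_r x^r lambda_(r,s)] tends to [mu_s] because the
summability assumption makes the series of [mu_s] absolutely convergent
([kernel_approximation], [funk_hecke_real]).

Finally [K p q] depends only on [p . q]: where [|p . q| < 1] the Taylor series
says so, and the points [q = p] and [q = - p] are reached by continuity along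
a great circle through [p] ([kernel_zonal]). *)

(** * Continuity of real functions *)

Section RealContinuity.
Context {R : realType} {T : topologicalType}.
Implicit Types f g : T -> R.

Lemma continuous_funM f g : continuous f -> continuous g ->
  continuous (fun x => f x * g x).
Proof. by move=> cf cg x; exact: (continuousM (cf x) (cg x)). Qed.

Lemma continuous_funD f g : continuous f -> continuous g ->
  continuous (fun x => f x + g x).
Proof. by move=> cf cg x; exact: (continuousD (cf x) (cg x)). Qed.

Lemma continuous_funN f : continuous f -> continuous (fun x => - f x).
Proof. by move=> cf x; exact: (continuousN (cf x)). Qed.

Lemma continuous_funB f g : continuous f -> continuous g ->
  continuous (fun x => f x - g x).
Proof. by move=> cf cg; apply: continuous_funD => //; exact: continuous_funN. Qed.

Lemma continuous_fun_cst (c : R) : continuous (fun _ : T => c).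
Proof. by move=> x; exact: cvg_cst. Qed.

Lemma continuous_fun_comp (h : R -> R) f :
  continuous h -> continuous f -> continuous (fun x => h (f x)).
Proof. by move=> ch cf x; exact: (continuous_comp (cf x) (ch (f x))). Qed.

Lemma continuous_funX (n : nat) f :
  continuous f -> continuous (fun x => f x ^+ n).
Proof.
move=> cf; apply: (continuous_fun_comp (fun y => y ^+ n)) => //.
exact: exprn_continuous.
Qed.

Lemma continuous_fun_sum (I : Type) (r : seq I) (P : pred I) (F : I -> T -> R) :
  (forall i, continuous (F i)) -> continuous (fun x => \sum_(i <- r | P i) F i x).
Proof.
move=> cF; elim: r => [|i r IH].
  by under eq_fun do rewrite big_nil; exact: continuous_fun_cst.
under eq_fun do rewrite big_cons; case: (P i) => //.
by apply: continuous_funD.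
Qed.

End RealContinuity.

(** * Integration over the sphere in spherical coordinates *)

Section SphereIntegral.
Context {R : realType}.
Notation V := 'cV[R]_3.
Notation mu := (@lebesgue_measure R).
Implicit Types (f g : V -> R) (phi theta : R) (p q : V).

Lemma continuous_entries {T : topologicalType} {m n : nat}
    (g : T -> 'M[R]_(m, n)) :
  (forall i j, continuous (fun x => g x i j)) -> continuous g.
Proof.
move=> cg x A [P Pg PA].
have Px i j : \forall y \near x, P i j (g y i j) by exact: cg (Pg i j).
have Pnear := @filter_forall _ _ _ _ (nbhs_filter x)
  (fun i => @filter_forall _ _ _ _ (nbhs_filter x) (Px i)).
by apply: filterS Pnear => y Py; exact: PA.
Qed.

Lemma coord_sph_point phi theta :
  (coord_x (sph_point phi theta) = sin theta * cos phi) *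
  (coord_y (sph_point phi theta) = sin theta * sin phi) *
  (coord_z (sph_point phi theta) = cos theta).
Proof. by rewrite /coord_x /coord_y /coord_z !mxE !inordK. Qed.

Lemma dotpE p q : dotp p q =
  coord_x p * coord_x q + coord_y p * coord_y q + coord_z p * coord_z q.
Proof.
rewrite /dotp !big_ord_recr big_ord0 /= add0r /coord_x /coord_y /coord_z.
by congr (_ + _ + _); congr (p _ _ * q _ _); apply: val_inj; rewrite /= inordK.
Qed.

Lemma unit_sphere_sph_point phi theta : unit_sphere (sph_point phi theta).
Proof.
rewrite /unit_sphere /= dotpE !coord_sph_point.
transitivity (sin theta ^+ 2 * (cos phi ^+ 2 + sin phi ^+ 2) + cos theta ^+ 2).
  by ring.
by rewrite cos2Dsin2 mulr1 addrC cos2Dsin2.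
Qed.

Lemma continuous_sph_point :
  continuous (fun x : R * R => sph_point x.1 x.2).
Proof.
apply: continuous_entries => i j.
have c1 (h : R -> R) : continuous h -> continuous (fun x : R * R => h x.1).
  by move=> ch x; apply: continuous_comp; [exact: cvg_fst|exact: ch].
have c2 (h : R -> R) : continuous h -> continuous (fun x : R * R => h x.2).
  by move=> ch x; apply: continuous_comp; [exact: cvg_snd|exact: ch].
have := c1 _ (@continuous_cos R); have := c1 _ (@continuous_sin R).
have := c2 _ (@continuous_cos R); have := c2 _ (@continuous_sin R).
move=> s2 k2 s1 k1.
under eq_fun do rewrite mxE.
case: i => -[|[|[|//]]] ? x /=.
- by apply: continuousM; [exact: s2|exact: k1].
- by apply: continuousM; [exact: s2|exact: s1].
- exact: k2.
Qed.

Lemma continuous_coord (i : 'I_3) (j : 'I_1) : continuous (fun q => q i j).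
Proof. exact: coord_continuous. Qed.

Lemma itv_integrable (h : R -> R) (a b : R) : continuous h ->
  mu.-integrable `[a, b] (EFin \o h).
Proof.
move=> ch; apply: continuous_compact_integrable; first exact: segment_compact.
exact: continuous_subspaceT.
Qed.

Lemma itvo_integrable (h : R -> R) (a b : R) : continuous h ->
  mu.-integrable `[a, b[ (EFin \o h).
Proof.
move=> ch; apply: (@integrableS _ _ _ mu `[a, b]) => //.
  exact: subset_itv_co_cc.
exact: itv_integrable.
Qed.

Definition meridian_integral f phi : R :=
  \int[mu]_(theta in `[0, pi]) (f (sph_point phi theta) * sin theta).

Lemma continuous_meridian f phi : continuous f ->
  continuous (fun theta => f (sph_point phi theta) * sin theta).
Proof.
move=> cf theta; apply: continuousM; last exact: continuous_sin.
apply: continuous_comp; last exact: cf.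
apply: (@continuous_comp _ _ _ (fun t => (phi, t)) (fun x => sph_point x.1 x.2)).
  by apply: (@cvg_pair _ _ _ (nbhs theta) (nbhs phi) (nbhs theta));
    [exact: cvg_cst|exact: cvg_id].
exact: continuous_sph_point.
Qed.

Lemma continuous_parallel f theta : continuous f ->
  continuous (fun phi => f (sph_point phi theta) * sin theta).
Proof.
move=> cf phi; apply: continuousM; last exact: cvg_cst.
apply: continuous_comp; last exact: cf.
apply: (@continuous_comp _ _ _ (fun t => (t, theta)) (fun x => sph_point x.1 x.2)).
  by apply: (@cvg_pair _ _ _ (nbhs phi) (nbhs phi) (nbhs theta));
    [exact: cvg_id|exact: cvg_cst].
exact: continuous_sph_point.
Qed.

(** The integrand is bounded on a compact neighbourhood of the given azimuth, so
dominated convergence applies with a constant bound. *)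
Lemma continuous_meridian_integral f : continuous f ->
  continuous (meridian_integral f).
Proof.
move=> cf phi0.
pose F phi theta := f (sph_point phi theta) * sin theta.
have [M FM] : exists M, forall phi theta, phi \in `[phi0 - 1, phi0 + 1] ->
    theta \in `[0, pi] -> `|F phi theta| <= M.
  have cpt : compact (`[phi0 - 1, phi0 + 1] `*` `[0, pi] : set (R * R)).
    by apply: compact_setX; exact: segment_compact.
  have cF : continuous (fun x : R * R => F x.1 x.2).
    move=> x; apply: continuousM.
      by apply: continuous_comp; [exact: continuous_sph_point|exact: cf].
    by apply: continuous_comp; [exact: cvg_snd|exact: continuous_sin].
  have := continuous_compact (continuous_subspaceT cF) cpt.
  move=> /compact_bounded[M [_ HM]]; exists (M + 1) => phi theta hp ht.
  by apply: (HM (M + 1)); [rewrite ltrDl|exists (phi, theta)].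
have := @continuity_under_integral R _ _ mu F `[0, pi] _ (phi0 - 1) (phi0 + 1)
  _ _ (fun=> M).
apply => //.
- by move=> phi _; apply: itv_integrable; exact: continuous_meridian.
- by apply: aeW => theta _ phi _; exact: continuous_parallel.
- by apply: itv_integrable => ?; exact: cvg_cst.
- move=> phi /= hp; apply: aeW => theta ht; apply: FM => //.
  exact: subset_itv_oo_cc.
- by rewrite inE/= in_itv/=; apply/andP; split; lra.
Qed.

Lemma sphere_integralE f :
  sphere_integral f = \int[mu]_(phi in `[0, 2 * pi[) meridian_integral f phi.
Proof. by []. Qed.

Lemma sphere_integralD f g : continuous f -> continuous g ->
  sphere_integral (fun q => f q + g q) = sphere_integral f + sphere_integral g.
Proof.
move=> cf cg; rewrite !sphere_integralE -RintegralD //; last 2 first.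
- by apply: itvo_integrable; exact: continuous_meridian_integral.
- by apply: itvo_integrable; exact: continuous_meridian_integral.
apply: eq_Rintegral => phi _; rewrite -RintegralD //; last 2 first.
- by apply: itv_integrable; exact: continuous_meridian.
- by apply: itv_integrable; exact: continuous_meridian.
by apply: eq_Rintegral => theta _; rewrite mulrDl.
Qed.

Lemma sphere_integralZ (c : R) f : continuous f ->
  sphere_integral (fun q => c * f q) = c * sphere_integral f.
Proof.
move=> cf; rewrite !sphere_integralE -RintegralZl //; last first.
  by apply: itvo_integrable; exact: continuous_meridian_integral.
apply: eq_Rintegral => phi _; rewrite -RintegralZl //; last first.
  by apply: itv_integrable; exact: continuous_meridian.
by apply: eq_Rintegral => theta _; rewrite mulrA.
Qed.

Lemma eq_sphere_integral f g : (forall q, unit_sphere q -> f q = g q) ->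
  sphere_integral f = sphere_integral g.
Proof.
move=> fg; apply: eq_Rintegral => phi _; apply: eq_Rintegral => theta _.
by rewrite fg //; exact: unit_sphere_sph_point.
Qed.

Lemma le_sphere_integral f g : continuous f -> continuous g ->
  (forall q, unit_sphere q -> f q <= g q) ->
  sphere_integral f <= sphere_integral g.
Proof.
move=> cf cg fg; apply: le_Rintegral => //.
- by apply: itvo_integrable; exact: continuous_meridian_integral.
- by apply: itvo_integrable; exact: continuous_meridian_integral.
move=> phi _; apply: le_Rintegral => //.
- by apply: itv_integrable; exact: continuous_meridian.
- by apply: itv_integrable; exact: continuous_meridian.
move=> theta; rewrite /= in_itv /= => th.
apply: ler_wpM2r; first exact: sin_ge0_pi.
exact/fg/unit_sphere_sph_point.
Qed.

(** Monomials in the coordinates are products of a function of the azimuth and a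
function of the polar angle; their integrals reduce to one-dimensional ones. *)
Lemma sphere_integral_separable f (a b : R -> R) :
  continuous a -> continuous b ->
  (forall phi theta, f (sph_point phi theta) * sin theta = a phi * b theta) ->
  sphere_integral f = (\int[mu]_(phi in `[0, 2 * pi]) a phi) *
                      (\int[mu]_(theta in `[0, pi]) b theta).
Proof.
move=> ca cb fab; rewrite sphere_integralE.
rewrite -(Rintegral_itv_bndo_bndc (itvo_integrable a 0 (2 * pi) ca)).
rewrite -RintegralZr //; last exact: itvo_integrable.
apply: eq_Rintegral => phi _; rewrite -RintegralZl //; last first.
  exact: itv_integrable.
by apply: eq_Rintegral => theta _; rewrite fab.
Qed.

End SphereIntegral.

(** * Trigonometric integrals *)

Section Trig.
Context {R : realType}.
Notation mu := (@lebesgue_measure R).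
Implicit Types (x : R).

Lemma Rintegral_is_derive (F f : R -> R) (a b : R) : a < b ->
  (forall x, is_derive x 1 F (f x)) -> continuous f ->
  \int[mu]_(x in `[a, b]) f x = F b - F a.
Proof.
move=> ab dF cf.
have cF x : {for x, continuous F}.
  apply: differentiable_continuous; apply/derivable1_diffP.
  by have [] := dF x.
rewrite /Rintegral (@continuous_FTC2 _ f F) //.
- exact: continuous_subspaceT.
- split.
  + by move=> x _; have [] := dF x.
  + by apply: cvg_at_right_filter; exact: cF.
  + by apply: cvg_at_left_filter; exact: cF.
- by move=> x _; rewrite derive1E; have [] := dF x.
Qed.

Definition cis x : R[i] := Complex (cos x) (sin x).

Lemma cisD x y : cis (x + y) = cis x * cis y.
Proof. by rewrite /cis sinD cosD; simpc; congr (_ +i* _)%C; rewrite addrC. Qed.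

Lemma cis0 : cis 0 = 1.
Proof. by rewrite /cis sin0 cos0. Qed.

Lemma cisMn (n : nat) x : cis (n%:R * x) = cis x ^+ n.
Proof.
elim: n => [|n IH]; first by rewrite mul0r cis0.
by rewrite -natr1 mulrDl mul1r cisD IH exprSr.
Qed.

Lemma cis2pi : cis (2 * pi) = 1.
Proof. by rewrite /cis mulr_natl cos2pi sin2pi. Qed.

Lemma cisNcis x : cis (- x) * cis x = 1.
Proof. by rewrite -cisD addNr cis0. Qed.

(** An integer frequency is written as a difference of two naturals because it
will arise from a monomial with [j] factors [xi] and [k] factors [eta]. *)
Lemma cis_period (j k : nat) : cis ((j%:R - k%:R) * (2 * pi)) = 1.
Proof.
have : cis ((j%:R - k%:R) * (2 * pi)) * cis (k%:R * (2 * pi)) =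
       cis (j%:R * (2 * pi)) by rewrite -cisD -mulrDl subrK.
by rewrite (cisMn j) (cisMn k) cis2pi !expr1n mulr1.
Qed.

Lemma integral_cos_freq (j k : nat) :
  \int[mu]_(phi in `[0, 2 * pi]) cos ((j%:R - k%:R) * phi) =
  if j == k then 2 * pi else 0.
Proof.
have pi2 : 0 < 2 * pi :> R by rewrite mulr_gt0 ?pi_gt0.
have [->|jk] := eqVneq j k.
  under eq_Rintegral do rewrite subrr mul0r cos0.
  rewrite Rintegral_cst //= lebesgue_measure_itv /= lte_fin pi2 sube0.
  by rewrite mul1r.
have c0 : j%:R - k%:R != 0 :> R by rewrite subr_eq0 eqr_nat.
have dF x : is_derive x 1 (fun x => (j%:R - k%:R)^-1 * sin ((j%:R - k%:R) * x))
    (cos ((j%:R - k%:R) * x)).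
  apply: is_derive_eq.
  by rewrite /GRing.scale /=; field.
rewrite (Rintegral_is_derive _ _ _ _ pi2 dF); last first.
  move=> x; apply: continuous_comp; last exact: continuous_cos.
  by apply: continuousM; [exact: cvg_cst|exact: cvg_id].
have [_ ->] := cis_period j k.
by rewrite !mulr0 sin0 mulr0 subr0.
Qed.

Lemma integral_sin_freq (j k : nat) :
  \int[mu]_(phi in `[0, 2 * pi]) sin ((j%:R - k%:R) * phi) = 0.
Proof.
have pi2 : 0 < 2 * pi :> R by rewrite mulr_gt0 ?pi_gt0.
have [->|jk] := eqVneq j k.
  under eq_Rintegral do rewrite subrr mul0r sin0.
  by rewrite Rintegral_cst //= mul0r.
have c0 : j%:R - k%:R != 0 :> R by rewrite subr_eq0 eqr_nat.
have dF x : is_derive x 1 (fun x => - (j%:R - k%:R)^-1 * cos ((j%:R - k%:R) * x))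
    (sin ((j%:R - k%:R) * x)).
  apply: is_derive_eq.
  by rewrite /GRing.scale /=; field.
rewrite (Rintegral_is_derive _ _ _ _ pi2 dF); last first.
  move=> x; apply: continuous_comp; last exact: continuous_sin.
  by apply: continuousM; [exact: cvg_cst|exact: cvg_id].
have [-> _] := cis_period j k.
rewrite mulr0 cos0. by rewrite subrr.
Qed.

(** Substituting [z = cos theta], this is the integral of [(1 - z^2)^a z^c] over
[-1, 1]. *)
Definition zonal_moment (a c : nat) : R :=
  \int[mu]_(theta in `[0, pi]) (sin theta ^+ (2 * a).+1 * cos theta ^+ c).

Lemma continuous_sincos (m n : nat) :
  continuous (fun x => sin x ^+ m * cos x ^+ n).
Proof.
apply: continuous_funM; apply: continuous_funX; first exact: continuous_sin.
exact: continuous_cos.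
Qed.

Lemma is_derive_fpow (f : R -> R) (n : nat) x df : is_derive x 1 f df ->
  is_derive x 1 (fun y => f y ^+ n) (n%:R * f x ^+ n.-1 * df).
Proof.
move=> dfx; have := @is_deriveX _ _ f n x 1 df dfx.
by congr is_derive; apply/funext => y; rewrite exprfctE.
Qed.

Lemma is_derive_fmul (f g : R -> R) x df dg :
  is_derive x 1 f df -> is_derive x 1 g dg ->
  is_derive x 1 (fun y => f y * g y) (f x * dg + df * g x).
Proof.
move=> dfx dgx; have := @is_deriveM _ _ f g x 1 df dg dfx dgx.
by rewrite /GRing.scale /= (mulrC df).
Qed.

Lemma zonal_moment0 (c : nat) :
  zonal_moment 0 c = (1 + (-1) ^+ c) / c.+1%:R.
Proof.
have c0 : c.+1%:R != 0 :> R by rewrite pnatr_eq0.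
have dF x : is_derive x 1 (fun x => - c.+1%:R^-1 * cos x ^+ c.+1)
    (sin x ^+ (2 * 0).+1 * cos x ^+ c).
  apply: is_derive_eq (is_derive_fmul _ _ _ _ _ (is_derive_cst _ _ _)
    (is_derive_fpow _ c.+1 _ _ (is_derive_cos x))) _.
  rewrite /cst muln0 expr1 mul0r addr0.
  change (- c.+1%:R^-1 * (c.+1%:R * cos x ^+ c * - sin x) = sin x * cos x ^+ c).
  by field.
rewrite /zonal_moment (Rintegral_is_derive _ _ _ _ (pi_gt0 R) dF).
  by rewrite cospi cos0 expr1n exprS; field.
exact: continuous_sincos.
Qed.

(** The derivative of [sin^(2a+2) cos^(c+1)], which vanishes at both end points,
is a combination of the two integrands. *)
Lemma zonal_momentS (a c : nat) :
  (2 * a + c + 3)%:R * zonal_moment a.+1 c = (2 * a + 2)%:R * zonal_moment a c.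
Proof.
(* the derivative of sin^(2a+2) cos^(c+1), with cos^2 rewritten as 1 - sin^2 *)
pose g x := (2 * a + 2)%:R * (sin x ^+ (2 * a).+1 * cos x ^+ c)
   - (2 * a + c + 3)%:R * (sin x ^+ (2 * a.+1).+1 * cos x ^+ c) : R.
have cZ (u : R) (m n : nat) : continuous (fun x => u * (sin x ^+ m * cos x ^+ n)).
  exact/(continuous_funM _ _ (continuous_fun_cst _))/continuous_sincos.
have cg : continuous g by apply: continuous_funB; exact: cZ.
have dF x : is_derive x 1 (fun x => sin x ^+ (2 * a).+2 * cos x ^+ c.+1) (g x).
  apply: is_derive_eq (is_derive_fmul _ _ _ _ _
    (is_derive_fpow _ (2 * a).+2 _ _ (is_derive_sin x))
    (is_derive_fpow _ c.+1 _ _ (is_derive_cos x))) _.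
  rewrite /g /= mulnS !exprS.
  have := cos2sin2 x.
  rewrite -(addn2 (2 * a)) -(addn1 c) !natrD.
  move: (sin x ^+ (2 * a)) (cos x ^+ c) (cos x) (sin x) => S C k s h.
  by ring: h.
have : \int[mu]_(x in `[0, pi]) g x = 0.
  rewrite (Rintegral_is_derive _ _ _ _ (pi_gt0 R) dF cg).
  by rewrite sinpi sin0 !exprS !mul0r subrr.
rewrite /g RintegralB //; [|exact: itv_integrable..].
rewrite !RintegralZl //; [|exact/itv_integrable/continuous_sincos..].
by move=> /eqP; rewrite subr_eq0 => /eqP ->.
Qed.

End Trig.

(** * Complex integrals of monomials *)

Section ComplexIntegral.
Context {R : realType}.
Notation V := 'cV[R]_3.
Notation C := R[i].
Notation Re := complex.Re.
Notation Im := complex.Im.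
Notation mu := (@lebesgue_measure R).
Implicit Types (f g : V -> C) (q : V) (c : C).

Lemma ReD (x y : C) : Re (x + y) = Re x + Re y. Proof. by case: x y => ? ? []. Qed.
Lemma ImD (x y : C) : Im (x + y) = Im x + Im y. Proof. by case: x y => ? ? []. Qed.
Lemma ReM (x y : C) : Re (x * y) = Re x * Re y - Im x * Im y.
Proof. by case: x y => ? ? []. Qed.
Lemma ImM (x y : C) : Im (x * y) = Re x * Im y + Im x * Re y.
Proof. by case: x y => ? ? []. Qed.

(** Stated on real and imaginary parts, since the complex integral is defined on
them. *)
Definition continuousC f :=
  continuous (fun q => Re (f q)) /\ continuous (fun q => Im (f q)).

Lemma continuousC_cst c : continuousC (fun=> c).
Proof. by split; exact: continuous_fun_cst. Qed.

Lemma continuousCD f g : continuousC f -> continuousC g ->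
  continuousC (fun q => f q + g q).
Proof.
move=> [rf jf] [rg jg]; split.
  by under eq_fun do rewrite ReD; exact: continuous_funD.
by under eq_fun do rewrite ImD; exact: continuous_funD.
Qed.

Lemma continuousCM f g : continuousC f -> continuousC g ->
  continuousC (fun q => f q * g q).
Proof.
move=> [rf jf] [rg jg]; split.
  by under eq_fun do rewrite ReM; apply: continuous_funB; exact: continuous_funM.
by under eq_fun do rewrite ImM; apply: continuous_funD; exact: continuous_funM.
Qed.

Lemma continuousCX f (n : nat) : continuousC f -> continuousC (fun q => f q ^+ n).
Proof.
move=> cf; elim: n => [|n IH]; first exact: continuousC_cst.
by under eq_fun do rewrite exprS; exact: continuousCM.
Qed.

Lemma continuousC_sum (I : Type) (r : seq I) (F : I -> V -> C) :
  (forall i, continuousC (F i)) -> continuousC (fun q => \sum_(i <- r) F i q).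
Proof.
move=> cF; elim: r => [|i r IH].
  by under eq_fun do rewrite big_nil; exact: continuousC_cst.
by under eq_fun do rewrite big_cons; exact: continuousCD.
Qed.

Lemma continuousC_real (h : V -> R) : continuous h ->
  continuousC (fun q => (h q)%:C%C).
Proof. by move=> ch; split=> //; exact: continuous_fun_cst. Qed.

Lemma sphere_integralCD f g : continuousC f -> continuousC g ->
  sphere_integralC (fun q => f q + g q) =
  sphere_integralC f + sphere_integralC g.
Proof.
move=> [rf jf] [rg jg]; rewrite /sphere_integralC.
have -> : (fun q => Re (f q + g q)) = (fun q => Re (f q) + Re (g q)).
  by apply/funext => q; rewrite ReD.
have -> : (fun q => Im (f q + g q)) = (fun q => Im (f q) + Im (g q)).
  by apply/funext => q; rewrite ImD.
by rewrite !sphere_integralD.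
Qed.

Lemma sphere_integralCZ c f : continuousC f ->
  sphere_integralC (fun q => c * f q) = c * sphere_integralC f.
Proof.
case: c => a b [rf jf]; rewrite /sphere_integralC.
have -> : (fun q => Re (Complex a b * f q)) =
    (fun q => a * Re (f q) + - b * Im (f q)).
  by apply/funext => q; rewrite ReM mulNr.
have -> : (fun q => Im (Complex a b * f q)) =
    (fun q => a * Im (f q) + b * Re (f q)).
  by apply/funext => q; rewrite ImM.
have cZ (r : R) (h : V -> R) : continuous h -> continuous (fun q => r * h q).
  by move=> ch; apply: continuous_funM => //; exact: continuous_fun_cst.
rewrite !sphere_integralD ?sphere_integralZ //; try exact: cZ.
by rewrite mulNr.
Qed.

Lemma sphere_integralC_sum (I : Type) (r : seq I) (F : I -> V -> C) :
  (forall i, continuousC (F i)) ->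
  sphere_integralC (fun q => \sum_(i <- r) F i q) =
  \sum_(i <- r) sphere_integralC (F i).
Proof.
move=> cF; elim: r => [|i r IH].
  under eq_fun do rewrite big_nil; rewrite big_nil.
  have := sphere_integralCZ 0 (fun=> 0) (continuousC_cst 0).
  by under eq_fun do rewrite mul0r; rewrite mul0r.
under eq_fun do rewrite big_cons; rewrite big_cons.
by rewrite sphere_integralCD ?IH //; exact: continuousC_sum.
Qed.

Lemma eq_sphere_integralC f g : (forall q, unit_sphere q -> f q = g q) ->
  sphere_integralC f = sphere_integralC g.
Proof.
move=> fg; rewrite /sphere_integralC.
rewrite (eq_sphere_integral (fun q => Re (f q)) (fun q => Re (g q))); last first.
  by move=> q /fg ->.
rewrite (eq_sphere_integral (fun q => Im (f q)) (fun q => Im (g q))) //.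
by move=> q /fg ->.
Qed.

Definition xi q : C := Complex (coord_x q) (coord_y q).
Definition eta q : C := Complex (coord_x q) (- coord_y q).
Definition zeta q : C := (coord_z q)%:C%C.

Lemma continuousC_xi : continuousC xi.
Proof. by split; exact: continuous_coord. Qed.
Lemma continuousC_eta : continuousC eta.
Proof. by split; [|apply: continuous_funN]; exact: continuous_coord. Qed.
Lemma continuousC_zeta : continuousC zeta.
Proof. by apply: continuousC_real; exact: continuous_coord. Qed.

Lemma xi_sph_point (phi theta : R) :
  xi (sph_point phi theta) = (sin theta)%:C%C * cis phi.
Proof.
by rewrite /xi !coord_sph_point /cis; simpc; congr Complex.
Qed.

Lemma eta_sph_point (phi theta : R) :
  eta (sph_point phi theta) = (sin theta)%:C%C * cis (- phi).
Proof.
by rewrite /eta !coord_sph_point /cis cosN sinN; simpc; congr Complex.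
Qed.

(** The azimuthal factor is [exp (i (j - k) phi)], whose integral vanishes
unless [j = k]. *)
Lemma sphere_moment (j k l : nat) :
  sphere_integralC (fun q => xi q ^+ j * eta q ^+ k * zeta q ^+ l) =
  if j == k then (2 * pi * zonal_moment j l)%:C%C else 0.
Proof.
have E (phi theta : R) :
    xi (sph_point phi theta) ^+ j * eta (sph_point phi theta) ^+ k *
    zeta (sph_point phi theta) ^+ l =
  (sin theta ^+ (j + k) * cos theta ^+ l)%:C%C * cis ((j%:R - k%:R) * phi).
  rewrite xi_sph_point eta_sph_point /zeta coord_sph_point !exprMn -!cisMn.
  rewrite mulrBl -mulrN cisD exprD !rmorphM !rmorphXn /=; ring.
have cs : continuous (fun theta : R => sin theta ^+ (j + k).+1 * cos theta ^+ l).
  exact: continuous_sincos.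
have cphi : continuous (fun phi : R => (j%:R - k%:R) * phi).
  by apply: continuous_funM; [exact: continuous_fun_cst|move=> x; exact: cvg_id].
rewrite /sphere_integralC.
rewrite (sphere_integral_separable _
  (fun phi => cos ((j%:R - k%:R) * phi)) _ _ cs); first last.
- move=> phi theta; rewrite E ReM /= mul0r subr0 exprS; ring.
- by apply: continuous_fun_comp => //; exact: continuous_cos.
rewrite (sphere_integral_separable _
  (fun phi => sin ((j%:R - k%:R) * phi)) _ _ cs); first last.
- move=> phi theta; rewrite E ImM /= mul0r addr0 exprS; ring.
- by apply: continuous_fun_comp => //; exact: continuous_sin.
rewrite integral_cos_freq integral_sin_freq mul0r.
case: eqVneq => [<-|_]; last by rewrite mul0r.
by rewrite /zonal_moment mul2n -addnn.
Qed.

Lemma zonal_moment_odd (a c : nat) : odd c -> zonal_moment a c = 0 :> R.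
Proof.
move=> oc; elim: a => [|a IH].
  by rewrite zonal_moment0 -signr_odd oc expr1 subrr mul0r.
have := @zonal_momentS R a c; rewrite IH mulr0 => /eqP.
by rewrite mulf_eq0 pnatr_eq0 addn3 /= => /eqP.
Qed.

(** Iterating [zonal_momentS] from [a = 0]; the factorials are kept on both sides
so that no division appears. *)
Lemma zonal_moment_even (a b : nat) :
  zonal_moment a (2 * b) * (2 * a + 2 * b).+1`!%:R * b`!%:R =
  (2 * 4 ^ a * a`! * (a + b)`! * (2 * b)`!)%:R :> R.
Proof.
elim: a => [|a IH].
  rewrite zonal_moment0 exprM sqrrN expr1n expr1n muln0 !add0n.
  rewrite factS fact0 !natrM expn0; field.
  by rewrite -natrM nat1r pnatr_eq0.
have -> : (2 * a.+1 + 2 * b).+1 = (2 * a + 2 * b).+3 by lia.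
have fS3 m : m.+3`!%:R = m.+3%:R * m.+2%:R * m.+1`!%:R :> R.
  by rewrite !factS !natrM !mulrA.
rewrite fS3; have := @zonal_momentS R a (2 * b).
have -> : (2 * a + 2 * b + 3 = (2 * a + 2 * b).+3)%N by lia.
move=> h; set N := (2 * a + 2 * b)%N in h IH *.
transitivity ((2 * a + 2)%:R * N.+2%:R *
   (zonal_moment a (2 * b) * N.+1`!%:R * b`!%:R) : R).
  move: (N.+3%:R) (N.+2%:R) (N.+1`!%:R) ((2 * a + 2)%:R) h => u v w t h.
  by ring: h.
rewrite IH -!natrM; congr _%:R.
by rewrite addSn !factS expnS /N; nia.
Qed.

End ComplexIntegral.

(** * Powers of linear forms *)

(** Used to compare coefficients: identities between integrals are proved for all
values of a parameter, then read off coefficient by coefficient. *)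
Lemma poly_eq_nat (F : numDomainType) (p q : {poly F}) :
  (forall n : nat, p.[n%:R] = q.[n%:R]) -> p = q.
Proof.
move=> pq; apply/eqP; rewrite -subr_eq0; apply/negPn/negP => d0.
pose rs := [seq n%:R : F | n <- iota 0 (size (p - q))].
have := @max_poly_roots _ (p - q) rs d0.
rewrite size_map size_iota ltnn => H; suff: false by []. apply: H.
- by apply/allP => _ /mapP[n _ ->]; rewrite /root hornerD hornerN pq subrr.
- by rewrite map_inj_uniq ?iota_uniq // => m n /eqP; rewrite eqr_nat => /eqP.
Qed.

Lemma sum_even_index (M : nmodType) (F : nat -> M) (n : nat) :
  \sum_(i < (2 * n).+1) (if odd i then 0 else F i) = \sum_(a < n.+1) F (2 * a)%N.
Proof.
elim: n => [|n IH]; first by rewrite !big_ord1.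
rewrite [RHS]big_ord_recr /= -IH mulnS !big_ord_recr /=.
by rewrite oddM /= addr0.
Qed.

Section PowerIntegrals.
Context {R : realType}.
Notation V := 'cV[R]_3.
Notation C := R[i].
Implicit Types (p q : V).

(** On the left is the weight of the monomial [xi^a eta^a z^(2b)] in the power of
a linear form times its integral, on the right the matching term of the
binomial expansion of [(4 al be + ga^2)^(a + b)]. *)
Lemma zonal_moment_binomial (a b : nat) :
  ('C(2 * (a + b), 2 * a) * 'C(2 * a, a))%:R * (2 * pi * zonal_moment a (2 * b)) =
  4 * pi / (2 * (a + b)).+1%:R * (4 ^ a * 'C(a + b, a))%:R :> R.
Proof.
have nf (n : nat) : n`!%:R != 0 :> R by rewrite pnatr_eq0 -lt0n fact_gt0.
have h1 := @zonal_moment_even R a b.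
have h2 : 'C(2 * (a + b), 2 * a)%:R * ((2 * a)`!%:R * (2 * b)`!%:R) =
    (2 * (a + b))`!%:R :> R.
  rewrite -!natrM -(@bin_fact (2 * (a + b)) (2 * a)); last by lia.
  by congr (_ * (_ * _`!))%:R; lia.
have h3 : 'C(2 * a, a)%:R * (a`!%:R * a`!%:R) = (2 * a)`!%:R :> R.
  by rewrite -!natrM -(@bin_fact (2 * a) a) //; [congr (_ * (_ * _`!))%:R|]; lia.
have h4 : 'C(a + b, a)%:R * (a`!%:R * b`!%:R) = (a + b)`!%:R :> R.
  by rewrite -!natrM -(@bin_fact (a + b) a) //; [congr (_ * (_ * _`!))%:R|]; lia.
have h5 : (2 * a + 2 * b).+1`!%:R = (2 * (a + b)).+1%:R * (2 * (a + b))`!%:R :> R.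
  by rewrite -mulnDr factS natrM.
rewrite h5 -h2 -h3 !natrM -h4 in h1.
apply: (mulfI (nf a)); apply: (mulfI (nf a)); apply: (mulfI (nf (2 * b)%N)).
apply: (mulfI (nf b)).
have N0 : (2 * (a + b)).+1%:R != 0 :> R by rewrite pnatr_eq0.
apply: (mulfI N0).
rewrite !natrM; move: h1 N0.
move: (zonal_moment _ _) ((2 * (a + b)).+1%:R) ('C(_, _)%:R) ('C(2 * a, a)%:R)
  ('C(a + b, a)%:R) (b`!%:R) (a`!%:R) ((2 * b)`!%:R) ((4 ^ a)%:R)
  => Z N c1 c2 c3 fb fa f2b p4 h N0.
have -> : N * (fb * (f2b * (fa * (fa * (4 * pi / N * (p4 * c3)))))) =
  2 * pi * (2 * p4 * fa * (c3 * (fa * fb)) * f2b) by field.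
by rewrite -h; ring.
Qed.

Definition linear_form (al be ga : C) q : C :=
  al * xi q + be * eta q + ga * zeta q.

Lemma continuousC_linear_form al be ga : continuousC (linear_form al be ga).
Proof.
apply: continuousCD; first apply: continuousCD; apply: continuousCM;
  try exact: continuousC_cst.
- exact: continuousC_xi.
- exact: continuousC_eta.
- exact: continuousC_zeta.
Qed.

(** For a real form of length [l], rotating it to [l z] would reduce this to
[int z^n dq].  The value for complex coefficients is what the null forms below
require, and it is obtained by expanding both sides: only the monomials
[xi^a eta^a z^(n - 2a)] contribute. *)
Lemma sphere_integral_power (al be ga : C) (n : nat) :
  sphere_integralC (fun q => linear_form al be ga q ^+ n) =
  if odd n then 0
  else (4 * pi / n.+1%:R)%:C%C * (4 * al * be + ga ^+ 2) ^+ n./2.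
Proof.
pose co i j : C :=
  (ga ^+ (n - i) * al ^+ (i - j) * be ^+ j) *+ ('C(n, i) * 'C(i, j)).
pose mon i j q := xi q ^+ (i - j) * eta q ^+ j * zeta q ^+ (n - i).
have cmon i j : continuousC (mon i j).
  apply: continuousCM; first apply: continuousCM; apply: continuousCX.
  - exact: continuousC_xi.
  - exact: continuousC_eta.
  - exact: continuousC_zeta.
have -> : (fun q => linear_form al be ga q ^+ n) =
    (fun q => \sum_(i < n.+1) \sum_(j < i.+1) co i j * mon i j q).
  apply/funext => q; rewrite /linear_form addrC exprDn; apply: eq_bigr => i _.
  rewrite exprDn mulr_sumr -sumrMnl; apply: eq_bigr => j _.
  rewrite /co /mon mulrnAr -mulrnA mulnC mulrnAl; congr (_ *+ _).
  by rewrite !exprMn; ring.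
have cco i j : continuousC (fun q => co i j * mon i j q).
  by apply: continuousCM => //; exact: continuousC_cst.
rewrite sphere_integralC_sum => [|i]; last exact: continuousC_sum.
under eq_bigr do rewrite sphere_integralC_sum //.
(* For a given power i of the non-zonal part, only j = i / 2 survives. *)
pose F i : C := co i i./2 * (2 * pi * zonal_moment i./2 (n - i))%:C%C.
have inner (i : 'I_n.+1) :
   \sum_(j < i.+1) sphere_integralC (fun q => co i j * mon i j q) =
   if odd i then 0 else F i.
  under eq_bigr do rewrite sphere_integralCZ // sphere_moment.
  case: ifP => oi.
    apply: big1 => j _; case: eqP => [e|]; last by rewrite mulr0.
    by exfalso; have := ltn_ord j; move: oi e; lia.
  have hi : (i./2 < i.+1)%N by lia.
  rewrite (bigD1 (Ordinal hi)) //= big1 ?addr0 => [|j].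
    have -> : (i - i./2 == i./2)%N by lia.
    by rewrite /F; have -> : (i - i./2 = i./2)%N by lia.
  rewrite -val_eqE /= => ji; case: eqP => [e|]; last by rewrite mulr0.
  by exfalso; have := ltn_ord j; move: oi ji e; lia.
under eq_bigr do rewrite inner.
case: ifP => on.
  apply: big1 => i _; case: ifP => // oi.
  rewrite /F zonal_moment_odd ?mulr0 ?rmorph0 ?mulr0 //.
  by have := ltn_ord i; lia.
have [m nE] : exists m, n = (2 * m)%N by exists n./2; lia.
rewrite nE sum_even_index -nE.
have -> : n./2 = m by lia.
rewrite addrC exprDn mulr_sumr; apply: eq_bigr => -[a /= am] _.
have ha : (2 * a)./2 = a by lia.
rewrite /F /co ha nE.
have -> : (2 * m - 2 * a = 2 * (m - a))%N by lia.
have -> : (2 * a - a = a)%N by lia.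
have := @zonal_moment_binomial a (m - a).
have -> : (a + (m - a) = m)%N by lia.
move=> /(congr1 (real_complex R)); rewrite !rmorphM /= => h.
move: h; rewrite !(rmorph_nat (real_complex R)) natrX => h.
rewrite -mulr_natr natrM -[X in _ = _ * X]mulr_natr exprM !exprMn.
move: h; move: (pi%:C)%C ((zonal_moment _ _)%:C)%C ((_^-1)%:C)%C => P Z N.
move: ('C(2 * m, 2 * a)%:R) ('C(2 * a, a)%:R) ('C(m, a)%:R) => c1 c2 c3.
move: (4 ^+ a) (ga ^+ 2 ^+ (m - a)) (al ^+ a) (be ^+ a) => f G A B h.
by ring: h.
Qed.

(** The form [t^2 xi + 2 t z - eta]: its square length
[4 t^2 (- 1) + (2 t)^2] is zero. *)
Definition null_form (t : C) q : C := linear_form (t ^+ 2) (- 1) (2 * t) q.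

(** The scalar product with [p], extended to a form with complex coefficients. *)
Definition dot_form p q : C := linear_form (eta p / 2) (xi p / 2) (zeta p) q.

Lemma dot_formE p q : dot_form p q = (dotp p q)%:C%C.
Proof.
have two : (2 : C) = (2 : R)%:C%C by rewrite (rmorph_nat (real_complex R)).
rewrite /dot_form /linear_form dotpE /xi /eta /zeta.
rewrite two -fmorphV /=; simpc; congr Complex; by field.
Qed.

(** Since the null form has square length 0 and [p] has length 1, the square
length of the sum is 1 plus twice the polar form of the two summands, which
is [h] times the value of the null form at [p]. *)
Lemma dot_null_power p t h n : unit_sphere p ->
  sphere_integralC (fun q => (dot_form p q + h * null_form t q) ^+ n) =
  if odd n then 0
  else (4 * pi / n.+1%:R)%:C%C * (1 + 2 * h * null_form t p) ^+ n./2.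
Proof.
move=> up; have := sphere_integral_power (eta p / 2 + h * t ^+ 2)
  (xi p / 2 - h) (zeta p + 2 * h * t) n.
have -> : linear_form (eta p / 2 + h * t ^+ 2)
  (xi p / 2 - h) (zeta p + 2 * h * t) = (fun q => dot_form p q + h * null_form t q).
  by apply/funext => q; rewrite /dot_form /null_form /linear_form; ring.
move=> ->; case: ifP => // _; congr (_ * _ ^+ _).
(* the square length of the form p . q, for a unit vector p *)
have e1 : eta p * xi p + zeta p ^+ 2 = 1.
  move: up; rewrite /unit_sphere /= dotpE => up.
  rewrite expr2 /eta /xi /zeta; simpc; apply/eqP; rewrite eq_complex /= -up.
  by apply/andP; split; apply/eqP; ring.
transitivity (eta p * xi p + zeta p ^+ 2 + 2 * h * null_form t p).
  by rewrite /null_form /linear_form; field.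
by rewrite e1.
Qed.

(** The number [lambda_(r,s)] by which the kernel [(p . q)^r] acts in degree [s],
in the form produced by comparing binomial coefficients; it is related to the
double factorials of [mu_s] in [mu_term_monomial_eigenvalue]. *)
Definition monomial_eigenvalue (r s : nat) : R :=
  if odd (r + s) then 0 else
  4 * pi * (2 ^ s * 'C((r + s)./2, s))%:R / ((r + s).+1 * 'C(r + s, s))%:R.

(** Both sides of [dot_null_power] with exponent [r + s] are polynomials in [h];
this is the equality of their coefficients of degree [s]. *)
Lemma dot_null_moment p t r s : unit_sphere p ->
  sphere_integralC (fun q => dot_form p q ^+ r * null_form t q ^+ s) =
  (monomial_eigenvalue r s)%:C%C * null_form t p ^+ s.
Proof.
move=> up.
pose N := (r + s)%N.
pose L : {poly C} := \poly_(k < N.+1)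
  ('C(N, k)%:R *
   sphere_integralC (fun q => dot_form p q ^+ (N - k) * null_form t q ^+ k)).
pose T : {poly C} := \poly_(k < N.+1) (if odd N then 0 else
  (4 * pi / N.+1%:R)%:C%C * ((2 * null_form t p) ^+ k *+ 'C(N./2, k))).
have cf k : continuousC (fun q => dot_form p q ^+ (N - k) * null_form t q ^+ k).
  by apply: continuousCM; apply: continuousCX; exact: continuousC_linear_form.
have LT : L = T.
  apply: poly_eq_nat => n; rewrite !horner_poly.
  have := dot_null_power p t n%:R N up.
  have -> : (fun q => (dot_form p q + n%:R * null_form t q) ^+ N) = (fun q =>
     \sum_(k < N.+1) ('C(N, k)%:R * n%:R ^+ k) *
       (dot_form p q ^+ (N - k) * null_form t q ^+ k)).
    apply/funext => q; rewrite exprDn; apply: eq_bigr => k _.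
    by rewrite -mulr_natr exprMn; ring.
  rewrite sphere_integralC_sum => [|k]; last first.
    by apply: continuousCM => //; exact: continuousC_cst.
  under eq_bigr do rewrite sphere_integralCZ //.
  move=> e; transitivity (if odd N then 0 else (4 * pi / N.+1%:R)%:C%C *
    (1 + 2 * n%:R * null_form t p) ^+ N./2).
    by rewrite -e; apply: eq_bigr => k _; ring.
  case: ifP => _; first by rewrite big1 // => k _; rewrite mul0r.
  rewrite exprDn mulr_sumr.
  (* The right-hand side has degree N / 2 in h; it is padded to degree N with
     zero binomial coefficients. *)
  have hN : (N./2.+1 <= N.+1)%N by lia.
  rewrite (big_ord_widen _ (fun k => (4 * pi / N.+1%:R)%:C%C * (1 ^+ (N./2 - k) *
    (2 * n%:R * null_form t p) ^+ k *+ 'C(N./2, k))) hN) big_mkcond /=.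
  apply: eq_bigr => k _; case: ltnP => hk.
    move: ((4 * pi / N.+1%:R)%:C)%C => A.
    rewrite expr1n mul1r -[RHS]mulrA [X in _ = A * X]mulrnAl; congr (_ * (_ *+ _)).
    by rewrite !exprMn; ring.
  by rewrite bin_small // mulr0n mulr0 mul0r.
have /(congr1 (fun P : {poly C} => P`_s)) := LT.
rewrite !coef_poly ltnS leq_addl /N addnK => e.
have c0 : 'C(r + s, s)%:R != 0 :> C.
  by rewrite pnatr_eq0 -lt0n bin_gt0 leq_addl.
apply: (mulfI c0); rewrite e /monomial_eigenvalue; case: ifP => _.
  by rewrite rmorph0 mul0r mulr0.
rewrite exprMn -mulr_natr !natrM !rmorphM !fmorphV !rmorphM /=.
rewrite !(rmorph_nat (real_complex R)) natrX; move: c0.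
have N0 : (r + s).+1%:R != 0 :> C by rewrite pnatr_eq0.
move: N0; move: ((r + s).+1%:R) ('C(r + s, s)%:R) => N1 c N0 c0.
by field; rewrite c0 N0.
Qed.


End PowerIntegrals.

(** * Solid harmonics as coefficients of powers of a null form *)

Lemma coef_of_horner_scale (F : numDomainType) (A B : {poly F}) (c : F) (n : nat) :
  (forall t, A.[t] = B.[c * t]) -> A`_n = c ^+ n * B`_n.
Proof.
move=> AB; have -> : A = \poly_(i < size B) (c ^+ i * B`_i).
  apply: poly_eq_nat => t; rewrite AB horner_coef horner_poly.
  by apply: eq_bigr => i _; rewrite exprMn; ring.
by rewrite coef_poly; case: ltnP => // h; rewrite nth_default ?mulr0.
Qed.

Section SolidHarmonics.
Context {R : realType}.
Notation V := 'cV[R]_3.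
Notation C := R[i].
Implicit Types (p q : V).

Definition null_poly q : {poly C} :=
  xi q *: 'X^2 + (2 * zeta q) *: 'X - (eta q)%:P.

(** The powers of a null form are harmonic, hence so are their coefficients in
[t]; on the sphere they are the spherical harmonics of degree [s] and order
[n - s] up to a factor. *)
Definition solid_harmonic (s n : nat) q : C := (null_poly q ^+ s)`_n.

Lemma horner_null_poly q t : (null_poly q).[t] = null_form t q.
Proof.
by rewrite /null_poly /null_form /linear_form !hornerE /=; ring.
Qed.

Lemma size_null_poly_exp q s : (size (null_poly q ^+ s) <= (2 * s).+1)%N.
Proof.
have h : (size (null_poly q) <= 3)%N.
  apply/leq_sizeP => j hj; rewrite coefB coefD !coefZ coefXn coefX coefC.
  by case: j hj => [|[|[|j]]] //= _; rewrite !mulr0 subr0 addr0.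
apply: leq_trans (size_poly_exp_leq _ _) _.
have : ((size (null_poly q)).-1 <= 2)%N by case: (size _) h => // -[|[|[]]].
by move=> h2; rewrite ltnS leq_mul2r h2 orbT.
Qed.

Lemma horner_null_poly_exp q s t :
  null_form t q ^+ s = \sum_(n < (2 * s).+1) solid_harmonic s n q * t ^+ n.
Proof.
by rewrite -horner_null_poly -horner_exp (horner_coef_wide _ (size_null_poly_exp q s)).
Qed.

(** The coefficients of the null polynomial are linear forms, and a coefficient of
a product is a sum of products of coefficients. *)
Lemma continuousC_solid_harmonic s n : continuousC (solid_harmonic s n).
Proof.
have c1 i : continuousC (fun q => (null_poly q)`_i).
  have -> : (fun q => (null_poly q)`_i) = fun q =>
    xi q * (i == 2)%:R + (2 * zeta q) * (i == 1)%:R - eta q * (i == 0)%:R.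
    apply/funext => q; rewrite /null_poly coefB coefD !coefZ coefXn coefX coefC.
    by case: (i == 0); rewrite ?mulr0 ?mulr1.
  have -> : (fun q => xi q * (i == 2)%:R + (2 * zeta q) * (i == 1)%:R -
                      eta q * (i == 0)%:R)
     = linear_form (i == 2)%:R (- (i == 0)%:R) (2 * (i == 1)%:R).
    by apply/funext => q; rewrite /linear_form; ring.
  exact: continuousC_linear_form.
rewrite /solid_harmonic; elim: s n => [|s IH] n.
  by rewrite (_ : (fun q => _) = (fun=> (1 : {poly C})`_n)) //; exact: continuousC_cst.
under eq_fun do rewrite exprS coefM.
by apply: continuousC_sum => i; apply: continuousCM.
Qed.

(** Equality of the coefficients of [t^n] in [dot_null_moment]. *)
Lemma solid_harmonic_moment p r s n : unit_sphere p ->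
  sphere_integralC (fun q => dot_form p q ^+ r * solid_harmonic s n q) =
  (monomial_eigenvalue r s)%:C%C * solid_harmonic s n p.
Proof.
move=> up.
have cH m : continuousC (fun q => dot_form p q ^+ r * solid_harmonic s m q).
  apply: continuousCM; last exact: continuousC_solid_harmonic.
  by apply: continuousCX; exact: continuousC_linear_form.
pose A : {poly C} := \poly_(m < (2 * s).+1)
  sphere_integralC (fun q => dot_form p q ^+ r * solid_harmonic s m q).
pose B : {poly C} := \poly_(m < (2 * s).+1)
  ((monomial_eigenvalue r s)%:C%C * solid_harmonic s m p).
have AB : A = B.
  apply: poly_eq_nat => t; rewrite !horner_poly.
  transitivity (sphere_integralC (fun q => dot_form p q ^+ r * null_form t%:R q ^+ s)).
    have -> : (fun q => dot_form p q ^+ r * null_form t%:R q ^+ s) = (fun q =>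
        \sum_(m < (2 * s).+1) t%:R ^+ m * (dot_form p q ^+ r * solid_harmonic s m q)).
      apply/funext => q; rewrite horner_null_poly_exp mulr_sumr.
      by apply: eq_bigr => m _; ring.
    rewrite sphere_integralC_sum => [|m]; last first.
      by apply: continuousCM => //; exact: continuousC_cst.
    by apply: eq_bigr => m _; rewrite sphere_integralCZ // mulrC.
  rewrite dot_null_moment // horner_null_poly_exp mulr_sumr.
  by apply: eq_bigr => m _; rewrite mulrA.
(* Above degree 2 s both sides are zero. *)
have [hn|hn] := leqP (2 * s).+1 n.
  have h0 q : solid_harmonic s n q = 0.
    by rewrite /solid_harmonic nth_default // (leq_trans (size_null_poly_exp q s)).
  rewrite h0 mulr0 (eq_sphere_integralC _ (fun q => 0 * 0)) => [|q _]; last first.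
    by rewrite h0 !mulr0.
  rewrite (sphere_integralCZ 0 (fun=> 0)) ?mul0r //; exact: continuousC_cst.
have := congr1 (fun P : {poly C} => P`_n) AB.
by rewrite /= !coef_poly hn.
Qed.

(** The polynomial on the left is [(X + mu)^2 - 1], so the coefficients of its
powers are the Taylor coefficients at [mu]. *)
Lemma taylor_legendre (s n : nat) (mu : R) :
  (('X^2 + (2 * mu) *: 'X + (mu ^+ 2 - 1)%:P) ^+ s)`_n =
  (('X ^+ 2 - 1) ^+ s : {poly R})^`N(n).[mu].
Proof.
set P : {poly R} := ('X ^+ 2 - 1) ^+ s.
have -> : ('X^2 + (2 * mu) *: 'X + (mu ^+ 2 - 1)%:P) ^+ s =
    \poly_(i < size P) P^`N(i).[mu].
  apply: poly_eq_nat => t; rewrite horner_poly -nderiv_taylor; last exact: mulrC.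
  by rewrite /P !hornerE /=; congr (_ ^+ _); ring.
rewrite coef_poly; case: ltnP => // h.
by rewrite nderivn_poly0 // horner0.
Qed.

(** With [c = sin theta e^(i phi)], multiplying the null form by [c] gives
[(c t)^2 + 2 cos theta (c t) - sin theta ^ 2], the polynomial of
[taylor_legendre] at [c t].  The powers of [c] are kept on both sides so that
the statement also makes sense at the poles, where [c = 0]. *)
Lemma solid_harmonic_sph_point s n (phi theta : R) :
  ((sin theta)%:C%C * cis phi) ^+ s * solid_harmonic s n (sph_point phi theta) =
  ((sin theta)%:C%C * cis phi) ^+ n *
    ((('X ^+ 2 - 1) ^+ s : {poly R})^`N(n).[cos theta])%:C%C.
Proof.
set c := (_ * cis phi)%R; set q := sph_point phi theta.
rewrite -taylor_legendre.
set Q : {poly R} := (X in X ^+ s).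
have -> : (((Q ^+ s)`_n)%:C)%C = (map_poly (real_complex R) Q ^+ s)`_n.
  by rewrite -rmorphXn coef_map.
rewrite -(@coef_of_horner_scale _ (c ^+ s *: null_poly q ^+ s)) ?coefZ // => t.
rewrite hornerZ !horner_exp -exprMn; congr (_ ^+ _).
have h1 : cis (- phi) * cis phi = 1 by exact: cisNcis.
have h2 : ((cos theta ^+ 2 - 1)%:C)%C = - ((sin theta)%:C)%C ^+ 2 :> C.
  by rewrite cos2sin2 -rmorphXn -rmorphN; congr (_%:C)%C; ring.
rewrite horner_null_poly /null_form /linear_form /Q.
move: (cos theta ^+ 2 - 1) h2 => d h2.
rewrite !rmorphD /= map_polyZ map_polyXn map_polyX map_polyC /= !hornerE /=.
rewrite xi_sph_point eta_sph_point /zeta coord_sph_point.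
rewrite h2 rmorphM (rmorph_nat (real_complex R)) /c.
by ring: h1.
Qed.

End SolidHarmonics.

(** * Spherical harmonics are solid harmonics *)

Section SphHarm.
Context {R : realType}.
Notation V := 'cV[R]_3.
Notation C := R[i].
Implicit Types (p q : V).

Lemma eq_coord p q : coord_x p = coord_x q -> coord_y p = coord_y q ->
  coord_z p = coord_z q -> p = q.
Proof.
rewrite /coord_x /coord_y /coord_z => ex ey ez; apply/matrixP => i j.
rewrite ord1; case: i => -[|[|[|//]]] lti; [move: ex|move: ey|move: ez];
  by congr (p _ _ = q _ _); apply: val_inj; rewrite /= inordK.
Qed.

Lemma unit_sphereE p : unit_sphere p ->
  coord_x p ^+ 2 + coord_y p ^+ 2 + coord_z p ^+ 2 = 1.
Proof. by rewrite /unit_sphere /= dotpE !expr2. Qed.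

Lemma sph_point_polar_azimuth p : unit_sphere p ->
  sph_point (azimuth p) (polar p) = p.
Proof.
move=> /unit_sphereE up.
have hz : -1 <= coord_z p <= 1 by apply/andP; split; nra.
have cz : cos (polar p) = coord_z p by rewrite /polar acosK // in_itv.
have [x0 y0] := (sqr_ge0 (coord_x p), sqr_ge0 (coord_y p)).
set rho := Num.sqrt (coord_x p ^+ 2 + coord_y p ^+ 2).
have rho2 : rho ^+ 2 = coord_x p ^+ 2 + coord_y p ^+ 2.
  by rewrite sqr_sqrtr // addr_ge0.
have sz : sin (polar p) = rho.
  by rewrite /polar sin_acos // /rho; congr Num.sqrt; rewrite -up; ring.
(* At the poles x and y vanish, whatever the azimuth. *)
have [r0|r0] := eqVneq rho 0.
  have h0 : coord_x p ^+ 2 + coord_y p ^+ 2 = 0 by rewrite -rho2 r0 expr0n.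
  by apply: eq_coord; rewrite coord_sph_point ?cz // sz r0 mul0r; nra.
have rgt0 : 0 < rho by rewrite lt_def r0 sqrtr_ge0.
have hx2 : (coord_x p / rho) ^+ 2 + (coord_y p / rho) ^+ 2 = 1.
  by rewrite !expr_div_n -mulrDl -rho2 mulfV // sqrf_eq0.
have hx : -1 <= coord_x p / rho <= 1 by apply/andP; split; nra.
pose a := acos (coord_x p / rho).
have ca : cos a = coord_x p / rho by rewrite /a acosK // in_itv.
have sa : sin a = `|coord_y p| / rho.
  rewrite /a sin_acos // -hx2 addrAC subrr add0r sqrtr_sqr normrM.
  by rewrite normfV (gtr0_norm rgt0).
have [caz saz] : cos (azimuth p) = coord_x p / rho /\
                 sin (azimuth p) = coord_y p / rho.
  rewrite /azimuth -/rho -/a; case: ifP => hy.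
    by rewrite ca sa ger0_norm.
  rewrite mulr_natl cosB sinB cos2pi sin2pi !mul0r !mul1r addr0 sub0r ca sa.
  by rewrite ler0_norm ?mulNr ?opprK // ltW // ltNge hy.
by apply: eq_coord; rewrite coord_sph_point ?cz // sz ?caz ?saz mulrC divfK.
Qed.

Lemma sin_polar_ge0 p : unit_sphere p -> 0 <= sin (polar p).
Proof.
move=> /unit_sphereE up.
have [x0 y0] := (sqr_ge0 (coord_x p), sqr_ge0 (coord_y p)).
have hz : -1 <= coord_z p <= 1 by apply/andP; split; nra.
by rewrite /polar sin_acos // sqrtr_ge0.
Qed.

Lemma sph_harm_norm_neq0 s (m : int) : @sph_harm_norm R s m != 0.
Proof.
rewrite /sph_harm_norm !mulf_neq0 //.
- by rewrite expfz_neq0 // oppr_eq0 oner_eq0.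
- rewrite gt_eqF // sqrtr_gt0 divr_gt0 // ?mulr_gt0 ?pi_gt0 //.
Qed.

(** Away from the poles one divides [solid_harmonic_sph_point] by the power of
[sin theta e^(i phi)].  At the poles the null polynomial is [2 cos theta t], so
only the order 0 survives, which agrees with the value of [0 `^ (m / 2)]. *)
Lemma rodrigues_solid s (m : int) (phi theta : R) :
  - s%:Z <= m <= s%:Z -> 0 <= sin theta ->
  cis (m%:~R * phi) * ((1 - cos theta ^+ 2) `^ (m%:~R / 2))%:C%C *
    ((('X ^+ 2 - 1) ^+ s : {poly R})^`N(absz (s%:Z + m)).[cos theta])%:C%C =
  solid_harmonic s (absz (s%:Z + m)) (sph_point phi theta).
Proof.
move=> /andP[sm ms] sin0.
set n := absz _; have nE : n%:Z = s%:Z + m by rewrite /n; lia.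
have mE : m%:~R = n%:R - s%:R :> R.
  have -> : m = n%:Z - s%:Z by rewrite nE; lia.
  by rewrite intrB.
rewrite -sin2cos2.
have [s0|s0] := eqVneq (sin theta) 0.
  have np : null_poly (sph_point phi theta) = (2 * (cos theta)%:C)%C *: 'X.
    rewrite /null_poly xi_sph_point eta_sph_point /zeta coord_sph_point s0.
    by rewrite rmorph0 !mul0r scale0r add0r subr0.
  rewrite /solid_harmonic np exprZn coefZ coefXn s0 expr0n /=.
  have [ns|ns] := eqVneq n s; last first.
    rewrite mulr0 powR0 ?rmorph0 ?mulr0 ?mul0r //.
    by rewrite mulf_neq0 ?invr_neq0 // mE subr_eq0 eqr_nat.
  rewrite mulr1 mE ns subrr !mul0r powRr0 cis0 !mul1r -taylor_legendre.
  have -> : cos theta ^+ 2 - 1 = 0 by rewrite cos2sin2 s0; ring.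
  rewrite addr0.
  have -> : 'X^2 + (2 * cos theta) *: 'X = ('X + (2 * cos theta)%:P) * 'X :> {poly R}.
    by rewrite [RHS]mulrDl mul_polyC -expr2.
  rewrite exprMn coefMXn ltnn subnn -horner_coef0 horner_exp !hornerE.
  by rewrite rmorphXn rmorphM (rmorph_nat (real_complex R)).
have sgt0 : 0 < sin theta by rewrite lt_def s0.
have e0 x : cis x != 0 :> C.
  by apply/eqP => e; have := cisNcis x; rewrite e mulr0 => /esym/eqP; rewrite oner_eq0.
have c0 : ((sin theta)%:C)%C * cis phi != 0.
  by rewrite mulf_neq0 // eq_complex /= negb_and s0.
apply: (mulfI (expf_neq0 s c0)).
rewrite solid_harmonic_sph_point mulrA; congr (_ * _).
have hc : cis phi ^+ s * cis (m%:~R * phi) = cis phi ^+ n.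
  by rewrite -!cisMn -cisD -mulrDl mE addrC subrK.
have hs : sin theta ^+ s * (sin theta ^+ 2) `^ (m%:~R / 2) = sin theta ^+ n.
  rewrite -!powR_mulrn // -powRrM -powRD; last by rewrite s0 implybT.
  by congr (_ `^ _); rewrite mE; field.
rewrite !exprMn -hc -!rmorphXn /= -hs rmorphM /=.
by ring.
Qed.

Lemma sph_harm_solid s (m : int) : - s%:Z <= m <= s%:Z ->
  exists2 c : R, c != 0 &
    forall q, unit_sphere q ->
      sph_harm s m q = c%:C%C * solid_harmonic s (absz (s%:Z + m)) q.
Proof.
move=> hm; pose n := absz (s%:Z + m).
exists (sph_harm_norm s m * (2 ^+ s * s`!%:R)^-1 * n`!%:R).
  have nf k : k`!%:R != 0 :> R by rewrite pnatr_eq0 -lt0n fact_gt0.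
  apply: mulf_neq0 (nf n); apply: mulf_neq0 (sph_harm_norm_neq0 s m) _.
  by apply/invr_neq0/mulf_neq0/nf/expf_neq0; rewrite pnatr_eq0.
move=> q uq; rewrite -{2}(sph_point_polar_azimuth q uq).
rewrite -rodrigues_solid //; last exact: sin_polar_ge0.
rewrite /sph_harm /sph_harm_coord /assoc_legendre nderivn_def hornerMn -/n.
rewrite -mulr_natr !rmorphM /= -/(cis _).
by ring.
Qed.

(** The derivative of order [n] of [(mu^2 - 1)^s] is a nonzero polynomial, so it
does not vanish at all the points [1 / (k + 2)]. *)
Lemma solid_harmonic_neq0 s n : (n <= 2 * s)%N ->
  exists2 q : V, unit_sphere q & solid_harmonic s n q != 0.
Proof.
move=> hn; pose P : {poly R} := ('X ^+ 2 - 1) ^+ s.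
have mP : P \is monic by rewrite monic_exp // -[1]polyC1 monicXnsubC.
have sP : (size P).-1 = (2 * s)%N.
  by rewrite size_exp -[1]polyC1 size_XnsubC.
have D0 : P^`N(n) != 0.
  apply/eqP => /(congr1 (fun p : {poly R} => p`_(2 * s - n))).
  rewrite coef_nderivn subnKC // -sP -lead_coefE (monicP mP) coef0 => /eqP.
  by rewrite pnatr_eq0 -leqn0 leqNgt bin_gt0 sP hn.
pose x (k : nat) : R := k.+2%:R^-1.
have [k Dk] : exists k, P^`N(n).[x k] != 0.
  apply: contrapT => nex.
  pose rs := [seq x k | k <- iota 0 (size P^`N(n))].
  have := @max_poly_roots _ _ rs D0.
  rewrite size_map size_iota ltnn => H; suff: false by []. apply: H.
  - apply/allP => _ /mapP[k _ ->]; apply/negPn/negP => Dk.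
    by apply: nex; exists k; rewrite /root in Dk.
  - rewrite map_inj_uniq ?iota_uniq // => i j /invr_inj /eqP.
    by rewrite eqr_nat => /eqP [].
have x1 : -1 <= x k <= 1.
  have : 0 < x k by rewrite invr_gt0 ltr0n.
  have : x k <= 1 by rewrite invf_le1 ?ler1n ?ltr0n.
  by move=> *; apply/andP; split; lra.
have x2 : x k ^+ 2 < 1.
  by rewrite exprn_ilt1 // ?invr_ge0 // invf_lt1 ?ltr1n ?ltr0n.
pose theta := acos (x k).
have ct : cos theta = x k by rewrite /theta acosK // in_itv.
have st : sin theta != 0.
  by rewrite /theta sin_acos // gt_eqF // sqrtr_gt0 subr_gt0.
exists (sph_point 0 theta); first exact: unit_sphere_sph_point.
have := solid_harmonic_sph_point s n 0 theta; rewrite ct cis0 mulr1 => h.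
have : ((sin theta)%:C)%C ^+ s * solid_harmonic s n (sph_point 0 theta) != 0.
  rewrite h mulf_neq0 ?expf_neq0 //.
    by rewrite eq_complex /= negb_and st.
  by rewrite eq_complex /= negb_and Dk.
by rewrite mulf_eq0 negb_or => /andP[].
Qed.

End SphHarm.

(** * The eigenvalues of the monomial kernels *)

Section Eigenvalues.
Context {R : realType}.
Implicit Types (a : nat -> R).

Lemma fact_double_fact (m : nat) :
  ((2 * m).+1)`! = (double_fact (2 * m).+1 * (2 ^ m * m`!))%N.
Proof.
elim: m => [//|m IH].
have -> : (2 * m.+1).+1 = (2 * m).+3 by lia.
rewrite 2!factS IH -[double_fact (2 * m).+3]/((2 * m).+3 * double_fact (2 * m).+1)%N.
by rewrite expnS factS; lia.
Qed.

Lemma monomial_eigenvalue_odd (r s : nat) :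
  odd (r + s) -> @monomial_eigenvalue R r s = 0.
Proof. by rewrite /monomial_eigenvalue => ->. Qed.

(** A monomial of degree less than [s] is orthogonal to the harmonics of degree
[s]; for even [r + s] the vanishing comes from ['C((r + s) / 2, s) = 0]. *)
Lemma monomial_eigenvalue_lt (r s : nat) :
  (r < s)%N -> @monomial_eigenvalue R r s = 0.
Proof.
move=> rs; rewrite /monomial_eigenvalue; case: ifP => // _.
by rewrite bin_small ?muln0 ?mulr0 ?mul0r //; lia.
Qed.

(** With [m = s + j], [(2m + 1)! = (2m + 1)!! 2^m m!] turns the binomial
coefficients into double factorials. *)
Lemma mu_term_monomial_eigenvalue a (s j : nat) :
  mu_term a s j = a (s + 2 * j)%N * monomial_eigenvalue (s + 2 * j) s.
Proof.
have nf k : k`!%:R != 0 :> R by rewrite pnatr_eq0 -lt0n fact_gt0.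
have h1 : (2 * s + 2 * j + 1)`!%:R =
    (double_fact (2 * s + 2 * j + 1))%:R * (2 ^+ s * 2 ^+ j * (s + j)`!%:R) :> R.
  have -> : (2 * s + 2 * j + 1 = (2 * (s + j)).+1)%N by lia.
  by rewrite -exprD -!natrX -!natrM -fact_double_fact.
have h2 : 'C(s + j, s)%:R * (s`!%:R * j`!%:R) = (s + j)`!%:R :> R.
  by rewrite -!natrM -(@bin_fact (s + j) s) //; [congr (_ * (_ * _`!))%:R|]; lia.
have h3 : 'C(2 * s + 2 * j, s)%:R * (s`!%:R * (s + 2 * j)`!%:R) =
    (2 * s + 2 * j)`!%:R :> R.
  rewrite -!natrM -(@bin_fact (2 * s + 2 * j) s); last by lia.
  by congr (_ * (_ * _`!))%:R; lia.
rewrite addn1 factS natrM -h3 in h1.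
rewrite /mu_term /monomial_eigenvalue.
have -> : odd (s + 2 * j + s) = false by lia.
have -> : ((s + 2 * j + s)./2 = s + j)%N by lia.
have -> : (s + 2 * j + s = 2 * s + 2 * j)%N by lia.
have c1 : 'C(2 * s + 2 * j, s)%:R != 0 :> R.
  by rewrite pnatr_eq0 -lt0n bin_gt0; lia.
have c2 : (2 * s + 2 * j).+1%:R != 0 :> R by rewrite pnatr_eq0.
have p2 k : 2 ^+ k != 0 :> R by rewrite expf_neq0 // pnatr_eq0.
have d0 : (double_fact (2 * s + 2 * j + 1))%:R != 0 :> R.
  apply/eqP => d; move: h1; rewrite -addn1 d mul0r => /eqP.
  by rewrite !mulf_eq0 (negbTE c1) addn1 (negbTE c2) !(negbTE (nf _)).
rewrite !natrM natrX.
move: h1 h2 c1 c2 d0 (p2 s) (p2 j) (nf s) (nf j) (nf (s + 2 * j)%N).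
rewrite -addn1; move: (double_fact _)%:R ((2 * s + 2 * j + 1)%:R)
  ('C(2 * s + 2 * j, s)%:R) ('C(s + j, s)%:R) (2 ^+ s) (2 ^+ j) (s`!%:R)
  (j`!%:R) ((s + 2 * j)`!%:R) ((s + j)`!%:R) (a (s + 2 * j)%N)
  => D N c1 c2 ts tj fs fj f2 fm A h1 h2 c10 N0 D0 ts0 tj0 fs0 fj0 f20.
have e : N * c1 * f2 = D * ts * tj * c2 * fj.
  apply: (mulfI fs0).
  transitivity (N * (c1 * (fs * f2))); first by ring.
  by rewrite h1 -h2; ring.
have -> : 4 * pi * A * f2 / (tj * fj * D) =
   4 * pi * A * (N * c1 * f2) / (N * c1 * (tj * fj * D)).
  by field; rewrite ?c10 ?N0 ?D0 ?tj0 ?fj0.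
rewrite e; field.
by rewrite ?c10 ?N0 ?D0 ?tj0 ?fj0.
Qed.

(** Only the exponents [s], [s + 2], [s + 4], and so on have a nonzero eigenvalue. *)
Lemma sum_monomial_eigenvalue (b : nat -> R) (s J : nat) :
  \sum_(0 <= r < s + 2 * J) b r * monomial_eigenvalue r s =
  \sum_(0 <= j < J) mu_term b s j.
Proof.
elim: J => [|J IH].
  rewrite muln0 addn0 [RHS]big_geq //; apply: big1_seq => r.
  by rewrite mem_index_iota => /andP[_ /monomial_eigenvalue_lt ->]; rewrite mulr0.
have -> : (s + 2 * J.+1 = (s + 2 * J).+2)%N by lia.
rewrite !big_nat_recr //= IH mu_term_monomial_eigenvalue.
by rewrite (@monomial_eigenvalue_odd (s + 2 * J).+1) ?mulr0 ?addr0 //; lia.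
Qed.

(** The terms of [mu_s] are those of the row [l = s] of the double series divided
by [(4 s + 1)^(3/2)], a number that is at least 1. *)
Lemma mu_term_bounded a (s : nat) :
  (\sum_(0 <= l <oo) \sum_(l <= r <oo | ~~ odd (r - l)) `|summability_term a l r|%:E
        < +oo)%E ->
  exists M : R, forall J, \sum_(0 <= j < J) `|mu_term a s j| <= M.
Proof.
set S := (X in (X < _)%E) => fS.
have ge0 l r : (0 <= `|summability_term a l r|%:E)%E by rewrite lee_fin.
have ge0i l : (0 <= \sum_(l <= r <oo | ~~ odd (r - l)) `|summability_term a l r|%:E)%E.
  by apply: nneseries_ge0 => *; exact: ge0.
have leS : (\sum_(s <= r <oo | ~~ odd (r - s)) `|summability_term a s r|%:E <= S)%E.
  apply: (le_trans _ (@nneseries_lim_ge _ _ _ _ s.+1 _)) => //.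
  by rewrite big_nat_recr //= leeDr // sume_ge0.
have le_term j : `|mu_term a s j| <= `|summability_term a s (s + 2 * j)|.
  rewrite /mu_term /summability_term.
  have -> : ((s + 2 * j - s)./2 = j)%N by lia.
  have -> : (s + (s + 2 * j) + 1 = 2 * s + 2 * j + 1)%N by lia.
  set D := (_ * _)^-1; set w := (_ `^ _).
  have -> : 4 * pi * w * a (s + 2 * j)%N * (s + 2 * j)`!%:R * D =
     w * (4 * pi * a (s + 2 * j)%N * (s + 2 * j)`!%:R * D) by ring.
  rewrite [leRHS]normrM ler_peMl //.
  have w1 : 1 <= w.
    rewrite /w -[leLHS](powRr0 (4 * s%:R + 1)) ler_powR //.
    by rewrite lerDr mulr_ge0.
  by rewrite ger0_norm // (le_trans _ w1).
have partial J : (\sum_(s <= r < s + 2 * J | ~~ odd (r - s)) `|summability_term a s r|)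
   = \sum_(0 <= j < J) `|summability_term a s (s + 2 * j)|.
  elim: J => [|J IH]; first by rewrite muln0 addn0 !big_geq.
  have -> : (s + 2 * J.+1 = (s + 2 * J).+2)%N by lia.
  rewrite big_mkcond !big_nat_recr /= -?big_mkcond ?IH; try lia.
  have -> : odd (s + 2 * J - s) = false by lia.
  have -> : odd ((s + 2 * J).+1 - s) by lia.
  exact: addr0.
exists (fine S) => J; apply: le_trans (ler_sum _ (fun j _ => le_term j)) _.
rewrite -partial -lee_fin fineK; last first.
  by rewrite ge0_fin_numE // nneseries_ge0.
rewrite -sumEFin; apply: le_trans leS.
by apply: nneseries_lim_ge.
Qed.

End Eigenvalues.

(** * Approximation of the kernel by polynomials *)

Section Approximation.
Context {R : realType}.
Implicit Types (a : nat -> R) (k : R -> R).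

(** Compactness of the segment makes the continuity of [(x, t) |-> k (x t)] at
[x = 1] uniform in [t]. *)
Lemma dilation_near (k : R -> R) (e : R) : continuous k -> 0 < e ->
  \forall x \near (1 : R), forall t, -1 <= t <= 1 -> `|k (x * t) - k t| < e.
Proof.
move=> ck e0.
have /compact_near_coveringP cov := @segment_compact R (-1) 1.
have H := cov R (nbhs (1 : R)) (fun x t => `|k (x * t) - k t| < e)
  (nbhs_filter _).
apply: filterS (H _) => [x Hx t t1|].
  by apply: Hx; rewrite /= in_itv.
move=> t _.
pose G (z : R * R) := k (z.2 * z.1) - k z.1.
have cG : continuous G.
  have cfst : continuous (fun z : R * R => z.1) by move=> z; exact: cvg_fst.
  have csnd : continuous (fun z : R * R => z.2) by move=> z; exact: cvg_snd.
  by apply: continuous_funB; apply: continuous_fun_comp => //; exact: continuous_funM.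
have G1 : G (t, 1) = 0 by rewrite /G /= mul1r subrr.
have /cvgrPdist_lt/(_ e e0) := cG (t, 1).
by apply: filterS => z; rewrite G1 sub0r normrN.
Qed.

Lemma cvg_series_mu_term a s (M : R) :
  (forall J, \sum_(0 <= j < J) `|mu_term a s j| <= M) -> cvgn (series (mu_term a s)).
Proof.
move=> HM; apply: normed_cvg; apply: nondecreasing_is_cvgn.
  by apply: nondecreasing_series => n _ _; exact: normr_ge0.
by exists M => _ [J _ <-]; exact: HM.
Qed.

Lemma series_tail (u : nat -> R) : (forall n, 0 <= u n) -> cvgn (series u) ->
  forall e, 0 < e -> exists J0, forall J, (J0 <= J)%N -> \sum_(J0 <= j < J) u j <= e.
Proof.
move=> u0 cu e e0.
have := (cvgrPdist_lt _ _).1 cu e e0 => -[J0 _ HJ]; exists J0 => J J0J.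
have nd : {homo series u : n m / (n <= m)%N >-> n <= m}.
  by apply: nondecreasing_series => n _ _; exact: u0.
rewrite -sub_series_geq //.
have := HJ J0 (leqnn _); have := nondecreasing_cvgn_le nd cu J.
have := nondecreasing_cvgn_le nd cu J0.
move=> h1 h2 /=; rewrite ger0_norm ?subr_ge0 // => h3.
by lra.
Qed.

Lemma mu_term_scale a (x : R) s j :
  mu_term (fun r => a r * x ^+ r) s j = x ^+ (s + 2 * j) * mu_term a s j.
Proof. by rewrite !mu_term_monomial_eigenvalue; ring. Qed.

(** Abel summation.  The approximating polynomial is a partial sum of the dilated
series [sum a_r x^r t^r] with [x < 1].  The factor [x] is chosen first, close
enough to 1 for [k (x t)] to be close to [k t] and for the first terms of
[mu_s] to change little; the truncation is chosen afterwards, beyond the point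
where the tails of [sum |a_r| x^r] and of the series of [mu_s] are small. *)
Lemma kernel_approximation a k s (M : R) :
  continuous k ->
  (forall t, `|t| < 1 -> series (fun r => a r * t ^+ r) @ \oo --> k t) ->
  (forall J, \sum_(0 <= j < J) `|mu_term a s j| <= M) ->
  forall e, 0 < e -> exists b : nat -> R, exists n : nat,
    (forall t, -1 <= t <= 1 -> `|\sum_(0 <= r < n) b r * t ^+ r - k t| <= e) /\
    `|\sum_(0 <= r < n) b r * monomial_eigenvalue r s - mu_eigen a s| <= e.
Proof.
move=> ck ak HM e e0.
have cm := cvg_series_mu_term a s M HM.
have e3 : 0 < e / 3 by lra.
have e2 : 0 < e / 2 by lra.
have cn : cvgn (series (fun j => `|mu_term a s j|)).
  apply: nondecreasing_is_cvgn.
    by apply: nondecreasing_series => n _ _; exact: normr_ge0.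
  by exists M => _ [J _ <-]; exact: HM.
have [J0 HJ0] := series_tail _ (fun n => normr_ge0 _) cn _ e3.
have [J1 _ HJ1] := (cvgrPdist_lt _ _).1 cm _ e3.
pose g (x : R) := \sum_(0 <= j < J0) `|mu_term a s j| * (1 - x ^+ (s + 2 * j)).
have cg : continuous g.
  apply: continuous_fun_sum => j.
  apply: continuous_funM; first exact: continuous_fun_cst.
  apply: continuous_funB; first exact: continuous_fun_cst.
  by apply: continuous_funX => x; exact: cvg_id.
have g1 : g 1 = 0 by rewrite /g big1 // => j _; rewrite expr1n subrr mulr0.
near (1 : R)^'- => x.
have x0 : 0 < x by near: x; apply: nbhs_left_gt; exact: ltr01.
have x1 : x < 1 by near: x; exact: nbhs_left_lt.
have gx : g x <= e / 3.
  have : `|g 1 - g x| < e / 3.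
    by near: x; exact: ((cvgrPdist_lt _ _).1 (cvg_at_left_filter (cg 1))).
  by rewrite g1 sub0r normrN => /ltW; apply: le_trans; exact: ler_norm.
have kx t : -1 <= t <= 1 -> `|k (x * t) - k t| < e / 2.
  by move: t; near: x; exact: (cvg_within _ (dilation_near k _ ck e2)).
have ca : cvgn (series (fun r => `|a r| * x ^+ r)).
  (* The midpoint (1 + x) / 2 is a point of convergence larger than x. *)
  apply: (@is_cvg_pseries_inside_norm _ a ((1 + x) / 2) x).
    apply/cvg_ex; exists (k ((1 + x) / 2)); apply: ak.
    by rewrite ger0_norm; lra.
  by rewrite !ger0_norm; lra.
have ge0a r : 0 <= `|a r| * x ^+ r by rewrite mulr_ge0 ?exprn_ge0 // ltW.
have [N HN] := series_tail _ ge0a ca _ e2.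
pose J := maxn N (maxn J0 J1); pose n := (s + 2 * J)%N.
exists (fun r => a r * x ^+ r), n; split.
  move=> t t1.
  have xt1 : `|x * t| < 1.
    rewrite normrM (ger0_norm (ltW x0)).
    have : `|t| <= 1 by rewrite ler_norml.
    by have := normr_ge0 t; nra.
  have hlim : `|\sum_(0 <= r < n) a r * x ^+ r * t ^+ r - k (x * t)| <= e / 2.
    have := ak _ xt1.
    set S := series _ => cS.
    have Sn m : (n <= m)%N -> `|S n - S m| <= e / 2.
      move=> nm; rewrite distrC /S sub_series_geq //.
      apply: le_trans (ler_norm_sum _ _ _) _.
      apply: (@le_trans _ _ (\sum_(n <= r < m) `|a r| * x ^+ r)).
        apply: ler_sum => r _; rewrite normrM; apply: ler_wpM2l => //.
        rewrite normrX normrM (ger0_norm (ltW x0)) exprMn.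
        by rewrite ler_piMr ?exprn_ge0 ?exprn_ile1 ?ler_norml // ltW.
      have Nn : (N <= n)%N.
        have NJ : (N <= J)%N by exact: leq_maxl.
        by rewrite (leq_trans NJ) // /n mul2n -addnn addnA leq_addl.
      apply: le_trans (HN m (leq_trans Nn nm)).
      by rewrite [leRHS](big_cat_nat Nn nm) /= lerDr sumr_ge0.
    have -> : \sum_(0 <= r < n) a r * x ^+ r * t ^+ r = S n.
      by apply: eq_bigr => r _; rewrite exprMn mulrA.
    have cd : (fun m => `|S n - S m|) @ \oo --> `|S n - k (x * t)|.
      by apply: cvg_norm; apply: cvgB => //; exact: cvg_cst.
    rewrite -(cvg_lim _ cd) //; apply: limr_le.
      by apply/cvg_ex; eexists; exact: cd.
    by exists n => // m /= nm; exact: Sn.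
  have := kx _ t1 => h2.
  have := ler_distD (k (x * t)) (\sum_(0 <= r < n) a r * x ^+ r * t ^+ r) (k t).
  by lra.
rewrite sum_monomial_eigenvalue.
under eq_bigr do rewrite mu_term_scale.
have hJ : `|series (mu_term a s) J - mu_eigen a s| <= e / 3.
  by rewrite distrC; apply/ltW/HJ1; rewrite /J /=; lia.
have hd : `|\sum_(0 <= j < J) x ^+ (s + 2 * j) * mu_term a s j -
     series (mu_term a s) J| <= e / 3 + e / 3.
  (* Damping by x changes a term by a small amount for j < J0, and by at most
     its absolute value in the tail. *)
  have diffE j : `|x ^+ (s + 2 * j) * mu_term a s j - mu_term a s j| =
      `|mu_term a s j| * (1 - x ^+ (s + 2 * j)).
    rewrite -{2}[mu_term a s j]mul1r -mulrBl normrM mulrC distrC.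
    by rewrite (ger0_norm (x := 1 - _)) // subr_ge0 exprn_ile1 // ltW.
  rewrite -sumrB.
  apply: le_trans (ler_norm_sum _ _ _) _.
  have J0J : (J0 <= J)%N by rewrite /J; lia.
  rewrite (big_cat_nat (leq0n J0) J0J) //=; apply: lerD.
    by apply: le_trans gx; apply: ler_sum => j _; rewrite diffE.
  apply: le_trans (HJ0 J J0J); apply: ler_sum => j _; rewrite diffE.
  by rewrite ler_piMr // lerBlDr lerDl exprn_ge0 // ltW.
have := ler_distD (series (mu_term a s) J)
  (\sum_(0 <= j < J) x ^+ (s + 2 * j) * mu_term a s j) (mu_eigen a s).
by lra.
Unshelve. all: by end_near.
Qed.

End Approximation.

(** * The Funk-Hecke formula for a continuous kernel *)

Section FunkHecke.
Context {R : realType}.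
Notation V := 'cV[R]_3.
Notation C := R[i].
Notation Re := complex.Re.
Notation Im := complex.Im.
Implicit Types (p q : V) (a : nat -> R).

Lemma dotp_unit_bounds p q : unit_sphere p -> unit_sphere q -> -1 <= dotp p q <= 1.
Proof.
move=> /unit_sphereE up /unit_sphereE uq; rewrite dotpE.
have h1 := sqr_ge0 (coord_x p - coord_x q).
have h2 := sqr_ge0 (coord_y p - coord_y q).
have h3 := sqr_ge0 (coord_z p - coord_z q).
have h4 := sqr_ge0 (coord_x p + coord_x q).
have h5 := sqr_ge0 (coord_y p + coord_y q).
have h6 := sqr_ge0 (coord_z p + coord_z q).
by apply/andP; split; lra.
Qed.

Lemma continuous_dotp p : continuous (dotp p).
Proof.
rewrite (_ : dotp p = fun q => coord_x p * coord_x q + coord_y p * coord_y q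
  + coord_z p * coord_z q); last by apply/funext => q; rewrite dotpE.
by apply: continuous_funD; first apply: continuous_funD; apply: continuous_funM;
  try exact: continuous_fun_cst; exact: continuous_coord.
Qed.

Lemma sphere_integral_poly_kernel (h : V -> R) (b lam : nat -> R) p c n :
  continuous h ->
  (forall r, sphere_integral (fun q => dotp p q ^+ r * h q) = lam r * c) ->
  sphere_integral (fun q => (\sum_(0 <= r < n) b r * dotp p q ^+ r) * h q) =
  (\sum_(0 <= r < n) b r * lam r) * c.
Proof.
move=> ch hlam.
have cr r : continuous (fun q => dotp p q ^+ r * h q).
  by apply: continuous_funM => //; apply: continuous_funX; exact: continuous_dotp.
elim: n => [|n IH].
  under eq_fun do rewrite big_geq // mul0r.
  rewrite big_geq // mul0r.
  have := sphere_integralZ 0 (fun=> 0 : R) (continuous_fun_cst 0).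
  by under eq_fun do rewrite mul0r; rewrite mul0r.
under eq_fun do rewrite big_nat_recr //= mulrDl -mulrA.
rewrite big_nat_recr //= mulrDl -IH sphere_integralD; last 2 first.
- apply: continuous_funM => //; apply: continuous_fun_sum => r.
  apply: continuous_funM; first exact: continuous_fun_cst.
  by apply: continuous_funX; exact: continuous_dotp.
- by apply: continuous_funM => //; exact: continuous_fun_cst.
by rewrite sphere_integralZ // hlam mulrA.
Qed.

(** Replacing [k] by a polynomial within [e] changes the integral by at most [e]
times the integral of [|h|] and the eigenvalue by at most [e]; let [e] tend to
0. *)
Lemma funk_hecke_real (h : V -> R) a k s (M : R) p (c : R) : unit_sphere p ->
  continuous h -> continuous k ->
  (forall t, `|t| < 1 -> series (fun r => a r * t ^+ r) @ \oo --> k t) ->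
  (forall J, \sum_(0 <= j < J) `|mu_term a s j| <= M) ->
  (forall r, sphere_integral (fun q => dotp p q ^+ r * h q) =
             monomial_eigenvalue r s * c) ->
  sphere_integral (fun q => k (dotp p q) * h q) = mu_eigen a s * c.
Proof.
move=> up ch ck ak HM hlam.
set X := sphere_integral _.
pose B := sphere_integral (fun q => `|h q|).
have cabs : continuous (fun q => `|h q|).
  by apply: (continuous_fun_comp (fun x : R => `|x|)) => // x; exact: norm_continuous.
have B0 : 0 <= B.
  have -> : 0 = sphere_integral (fun q : V => 0 * 0 : R).
    by rewrite (sphere_integralZ 0 (fun=> 0)) ?mul0r //; exact: continuous_fun_cst.
  apply: le_sphere_integral => //; first exact: continuous_fun_cst.
  by move=> q _; rewrite mul0r.
have bound e : 0 < e -> `|X - mu_eigen a s * c| <= e * (B + `|c|).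
  move=> e0; have [b [n [hQ hmu]]] := kernel_approximation a k s M ck ak HM e e0.
  pose Q t := \sum_(0 <= r < n) b r * t ^+ r.
  have cQ : continuous (fun q => Q (dotp p q)).
    apply: continuous_fun_sum => r.
    apply: continuous_funM; first exact: continuous_fun_cst.
    by apply: continuous_funX; exact: continuous_dotp.
  have IQ : sphere_integral (fun q => Q (dotp p q) * h q) =
     (\sum_(0 <= r < n) b r * monomial_eigenvalue r s) * c.
    exact: sphere_integral_poly_kernel.
  have ckp : continuous (fun q => k (dotp p q)).
    by apply: continuous_fun_comp => //; exact: continuous_dotp.
  have ce : continuous (fun q => e * `|h q|).
    by apply: continuous_funM => //; exact: continuous_fun_cst.
  have eB : e * B = sphere_integral (fun q => e * `|h q|).
    by rewrite sphere_integralZ.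
  have cQh : continuous (fun q => Q (dotp p q) * h q) by exact: continuous_funM.
  have ckh : continuous (fun q => k (dotp p q) * h q) by exact: continuous_funM.
  have pw q : unit_sphere q ->
      `|k (dotp p q) * h q - Q (dotp p q) * h q| <= e * `|h q|.
    move=> uq; rewrite -mulrBl normrM ler_wpM2r // distrC.
    exact/hQ/dotp_unit_bounds.
  have h1 : X <= e * B + sphere_integral (fun q => Q (dotp p q) * h q).
    rewrite eB -(sphere_integralD _ _ ce cQh).
    apply: le_sphere_integral => //; first exact: continuous_funD.
    by move=> q /pw; rewrite ler_norml => /andP[_]; rewrite lerBlDr.
  have h2 : sphere_integral (fun q => Q (dotp p q) * h q) <= e * B + X.
    rewrite eB -(sphere_integralD _ _ ce ckh).
    apply: le_sphere_integral => //; first exact: continuous_funD.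
    by move=> q /pw; rewrite distrC ler_norml => /andP[_]; rewrite lerBlDr.
  have h3 : `|(\sum_(0 <= r < n) b r * monomial_eigenvalue r s) * c -
              mu_eigen a s * c|
      <= e * `|c|.
    by rewrite -mulrBl normrM ler_wpM2r.
  move: h1 h2 h3; rewrite IQ !ler_norml mulrDr => h1 h2 /andP[h3 h4].
  clear -h1 h2 h3 h4; clearbody X B.
  by apply/andP; split; lra.
apply/eqP; rewrite -subr_eq0 -normr_eq0; apply/negPn/negP => X0.
have Xgt0 : 0 < `|X - mu_eigen a s * c| by rewrite lt_def X0 normr_ge0.
move: Xgt0 bound; set Y := `|_| => Y0 bound.
have D0 : 0 < B + `|c| + 1 by rewrite ltr_wpDl // addr_ge0.
(* The 1 in the denominator makes the bound on Y strictly smaller than Y. *)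
have /bound : 0 < Y / (B + `|c| + 1) by rewrite divr_gt0.
rewrite mulrAC ler_pdivlMr //; apply/negP; rewrite -ltNge.
by rewrite ltr_pM2l // ltrDl.
Qed.

Lemma funk_hecke_solid a k s n (M : R) p : unit_sphere p -> continuous k ->
  (forall t, `|t| < 1 -> series (fun r => a r * t ^+ r) @ \oo --> k t) ->
  (forall J, \sum_(0 <= j < J) `|mu_term a s j| <= M) ->
  sphere_integralC (fun q => (k (dotp p q))%:C%C * solid_harmonic s n q) =
  (mu_eigen a s)%:C%C * solid_harmonic s n p.
Proof.
move=> up ck ak HM.
have [cre cim] := @continuousC_solid_harmonic R s n.
have ReZ (x : R) (z : C) : Re (x%:C%C * z) = x * Re z by rewrite ReM /= mul0r subr0.
have ImZ (x : R) (z : C) : Im (x%:C%C * z) = x * Im z by rewrite ImM /= mul0r addr0.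
have mom r : sphere_integral (fun q => dotp p q ^+ r * Re (solid_harmonic s n q)) =
      monomial_eigenvalue r s * Re (solid_harmonic s n p) /\
    sphere_integral (fun q => dotp p q ^+ r * Im (solid_harmonic s n q)) =
      monomial_eigenvalue r s * Im (solid_harmonic s n p).
  have e := solid_harmonic_moment p r s n up.
  rewrite -ReZ -ImZ -e /sphere_integralC /=.
  by split; congr sphere_integral; apply/funext => q;
    rewrite dot_formE -rmorphXn /= ?ReZ ?ImZ.
apply/eqP; rewrite eq_complex ReZ ImZ /sphere_integralC [Re (Complex _ _)]/=
  [Im (Complex _ _)]/=; apply/andP; split; apply/eqP.
- rewrite -(funk_hecke_real _ a k s M p _ up cre ck ak HM (fun r => (mom r).1)).
  by congr sphere_integral; apply/funext => q; rewrite ReZ.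
- rewrite -(funk_hecke_real _ a k s M p _ up cim ck ak HM (fun r => (mom r).2)).
  by congr sphere_integral; apply/funext => q; rewrite ImZ.
Qed.

End FunkHecke.

(** * Zonal kernels *)

Section Kernel.
Context {R : realType}.
Notation V := 'cV[R]_3.
Implicit Types (p q : V) (a : nat -> R).

Lemma continuous_within_comp {T U W : topologicalType} (A : set U)
    (f : U -> W) (g : T -> U) :
  {within A, continuous f} -> continuous g -> (forall x, A (g x)) ->
  continuous (f \o g).
Proof.
move=> /subspace_continuousP cf cg Ag x; apply: cvg_comp (cf _ (Ag x)).
move=> S AS; have near_x : \forall y \near x, A (g y) -> S (g y) by exact: cg AS.
by apply: filterS near_x => y; apply; exact: Ag.
Qed.

Lemma continuous_sphere_comp (f : V -> R) (g : R -> V) :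
  {within unit_sphere, continuous f} ->
  (forall i, continuous (fun t => g t i ord0)) -> (forall t, unit_sphere (g t)) ->
  continuous (fun t => f (g t)).
Proof.
move=> cf cg ug; apply: continuous_within_comp cf _ ug.
by apply: continuous_entries => i j; rewrite ord1.
Qed.

(** The meridian through [p], parametrised by the angle from [p]. *)
Definition great_circle p (tau : R) : V := sph_point (azimuth p) (polar p + tau).

Lemma dotp_great_circle p tau : unit_sphere p ->
  dotp p (great_circle p tau) = cos tau.
Proof.
move=> up; rewrite -{1}(sph_point_polar_azimuth p up) dotpE !coord_sph_point.
transitivity (sin (polar p) * sin (polar p + tau)
   * (cos (azimuth p) ^+ 2 + sin (azimuth p) ^+ 2)
   + cos (polar p) * cos (polar p + tau)).
  by ring.
rewrite cos2Dsin2 mulr1 addrC -cosB -[RHS]cosN; congr cos; ring.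
Qed.

Lemma continuous_great_circle (f : V -> R) p : {within unit_sphere, continuous f} ->
  continuous (fun tau => f (great_circle p tau)).
Proof.
move=> cf; apply: continuous_sphere_comp cf _ _ => [i|t]; last first.
  exact: unit_sphere_sph_point.
have cs (h : R -> R) : continuous h -> continuous (fun t => h (polar p + t)).
  move=> ch; apply: continuous_fun_comp => //.
  apply: continuous_funD; first exact: continuous_fun_cst.
  by move=> t; exact: cvg_id.
have s := cs _ (@continuous_sin R); have c := cs _ (@continuous_cos R).
under eq_fun do rewrite mxE.
case: i => -[|[|[|//]]] ? /=; first
  [exact: c|apply: continuous_funM => //; exact: continuous_fun_cst].
Qed.

Lemma dotp_eq1 p q : unit_sphere p -> unit_sphere q -> dotp p q = 1 -> q = p.
Proof.
move=> /unit_sphereE up /unit_sphereE uq; rewrite dotpE => h.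
have hs : (coord_x q - coord_x p) ^+ 2 + (coord_y q - coord_y p) ^+ 2
   + (coord_z q - coord_z p) ^+ 2 = 0.
  by rewrite !sqrrB; lra.
have h1 := sqr_ge0 (coord_x q - coord_x p).
have h2 := sqr_ge0 (coord_y q - coord_y p).
have h3 := sqr_ge0 (coord_z q - coord_z p).
by apply: eq_coord; apply/eqP; rewrite -subr_eq0 -sqrf_eq0; apply/eqP; lra.
Qed.

Lemma continuous_eq_right (f g : R -> R) x e : continuous f -> continuous g -> 0 < e ->
  (forall t, x < t < x + e -> f t = g t) -> f x = g x.
Proof.
move=> cf cg e0 fg.
have c1 := cvg_at_right_filter (cf x); have c2 := cvg_at_right_filter (cg x).
apply: (cvg_unique _ c1 _) => //; apply: cvg_trans c2; apply: near_eq_cvg.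
near=> t; apply/esym/fg/andP; split.
  by near: t; exact: nbhs_right_gt.
by near: t; apply: nbhs_right_lt; rewrite ltrDl.
Unshelve. all: by end_near.
Qed.


Section Profile.
Context (K : V -> V -> R) (a : nat -> R)
  (K_cont : forall p, unit_sphere p ->
     {within unit_sphere, continuous (fun q => K p q)})
  (K_taylor : forall p q, unit_sphere p -> unit_sphere q ->
     `|dotp p q| < 1 ->
     series (fun r => a r * dotp p q ^+ r) @ \oo --> K p q).

(** Both values are the sum of the same convergent series. *)
Lemma kernel_eq_inside p q p' q' : unit_sphere p -> unit_sphere q ->
  unit_sphere p' -> unit_sphere q' -> dotp p q = dotp p' q' ->
  `|dotp p q| < 1 -> K p q = K p' q'.
Proof.
move=> up uq up' uq' e lt1; have c1 := K_taylor p q up uq lt1.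
have := K_taylor p' q' up' uq'; rewrite -e => /(_ lt1) c2.
exact: (cvg_unique _ c1 c2).
Qed.

(** Both sides are continuous in [tau] and, by [kernel_eq_inside], agree where
[|cos tau| < 1], hence on an open interval to the right of every [tau]. *)
Lemma kernel_great_circle p p' tau : unit_sphere p -> unit_sphere p' ->
  0 <= tau <= pi -> K p (great_circle p tau) = K p' (great_circle p' tau).
Proof.
move=> up up' /andP[t0 tpi].
have ugc q t : unit_sphere (great_circle q t) by exact: unit_sphere_sph_point.
have gen t : sin t != 0 -> K p (great_circle p t) = K p' (great_circle p' t).
  move=> st; apply: kernel_eq_inside => //; rewrite !dotp_great_circle //.
  by rewrite lt_neqAle norm_cos_eq1 st cos_max.
have cp := continuous_great_circle (K p) p (K_cont p up).
have cp' := continuous_great_circle (K p') p' (K_cont p' up').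
have pi2 := pi_ge2 R.
apply: (continuous_eq_right (fun t => K p (great_circle p t))
  (fun t => K p' (great_circle p' t)) tau (if tau < pi then pi - tau else pi) cp cp').
  by case: ifP => h; [rewrite subr_gt0|exact: pi_gt0].
move=> t /andP[h1 h2]; apply: gen; case: ifPn h2 => [_ h2|].
  have s0 : 0 < sin t by apply: sin_gt0_pi; apply/andP; split; lra.
  by rewrite gt_eqF.
rewrite -leNgt => h2 h3; have -> : t = (t - pi) + pi by ring.
have s0 : 0 < sin (t - pi) by apply: sin_gt0_pi; apply/andP; split; lra.
by rewrite sinDpi oppr_eq0 gt_eqF.
Qed.

Definition north : V := sph_point 0 0.

(** The profile is read off along a meridian from the north pole.  If
[|p . q| = 1] then [q] itself lies on the great circle of [p]. *)
Lemma kernel_zonal : exists k : R -> R,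
  forall p q, unit_sphere p -> unit_sphere q -> K p q = k (dotp p q).
Proof.
exists (fun t => K north (great_circle north (acos t))) => p q up uq.
have un : unit_sphere north by exact: unit_sphere_sph_point.
have t1 := dotp_unit_bounds p q up uq.
have ct : cos (acos (dotp p q)) = dotp p q by rewrite acosK // in_itv.
have tau1 : 0 <= acos (dotp p q) <= pi by rewrite acos_ge0 ?acos_lepi.
rewrite -(kernel_great_circle p north _ up un tau1).
have [lt1|] := boolP (`|dotp p q| < 1).
  apply: kernel_eq_inside => //; first exact: unit_sphere_sph_point.
  by rewrite dotp_great_circle.
rewrite -leNgt => ge1; congr (K p _).
have [e1|e1] : dotp p q = 1 \/ dotp p q = - 1.
  by case/andP: t1; case: (ger0P (dotp p q)) ge1 => *; [left|right]; lra.
  rewrite e1 acos1 /great_circle addr0 sph_point_polar_azimuth //.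
  exact: dotp_eq1.
have dotN q' : dotp (- p) q' = - dotp p q'.
  by rewrite !dotpE /coord_x /coord_y /coord_z !mxE; ring.
have uN : unit_sphere (- p).
  by move: up; rewrite /unit_sphere /= !dotpE /coord_x /coord_y /coord_z !mxE !mulrNN.
have -> : great_circle p (acos (dotp p q)) = - p.
  apply: dotp_eq1 => //; first exact: unit_sphere_sph_point.
  by rewrite dotN dotp_great_circle // ct e1 opprK.
by apply: dotp_eq1 => //; rewrite dotN e1 opprK.
Qed.

(** Truncating the variable to [-1, 1] extends a profile to a continuous function
on the whole line, so that the kernel becomes continuous on the whole space
and not just on the sphere. *)
Definition clamp (t : R) : R := Num.max (-1) (Num.min 1 t).

Lemma clamp_bounds t : -1 <= clamp t <= 1.
Proof.
rewrite /clamp le_max lexx /= ge_max ge_min lexx /= andbT.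
by lra.
Qed.

Lemma clamp_id t : -1 <= t <= 1 -> clamp t = t.
Proof. by move=> /andP[h1 h2]; rewrite /clamp (min_idPr h2) (max_idPr h1). Qed.

Definition zonal_point (t : R) : V :=
  \col_(i < 3) [:: Num.sqrt (1 - clamp t ^+ 2); 0; clamp t]`_i.

Lemma dotp_north_zonal_point t : dotp north (zonal_point t) = clamp t.
Proof.
rewrite dotpE /north !coord_sph_point sin0 cos0 !mul0r !add0r mul1r.
by rewrite /coord_z !mxE inordK.
Qed.

Lemma unit_sphere_zonal_point t : unit_sphere (zonal_point t).
Proof.
rewrite /unit_sphere /= dotpE /coord_x /coord_y /coord_z !mxE !inordK //=.
rewrite -expr2 sqr_sqrtr; first by ring.
by have := clamp_bounds t => /andP[? ?]; nra.
Qed.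

Lemma kernel_profile (k : R -> R) :
  (forall p q, unit_sphere p -> unit_sphere q -> K p q = k (dotp p q)) ->
  exists kc : R -> R, [/\ continuous kc,
    forall p q, unit_sphere p -> unit_sphere q -> k (dotp p q) = kc (dotp p q) &
    forall t, `|t| < 1 -> series (fun r => a r * t ^+ r) @ \oo --> kc t].
Proof.
move=> Kk; have un : unit_sphere north by exact: unit_sphere_sph_point.
have kcE t : K north (zonal_point t) = k (clamp t).
  by rewrite Kk ?dotp_north_zonal_point //; exact: unit_sphere_zonal_point.
exists (fun t => K north (zonal_point t)); split.
- apply: (continuous_sphere_comp (K north));
    [exact: K_cont| |exact: unit_sphere_zonal_point].
  have cc : continuous clamp.
    move=> t; have cmin : {for t, continuous (fun x : R => Num.min 1 x)}.
      exact: (continuous_min (f := fun=> 1) (cvg_cst _) cvg_id).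
    exact: (continuous_max (f := fun=> -1) (cvg_cst _) cmin).
  move=> i; under eq_fun do rewrite mxE; case: i => -[|[|[|//]]] ? /=.
  + apply: (continuous_fun_comp Num.sqrt); first exact: sqrt_continuous.
    by apply: continuous_funB; [exact: continuous_fun_cst|exact: continuous_funX].
  + exact: continuous_fun_cst.
  + exact: cc.
- by move=> p q up uq; rewrite kcE clamp_id //; exact: dotp_unit_bounds.
- move=> t t1; have ct : clamp t = t.
    by apply: clamp_id; rewrite -ler_norml ltW.
  have := K_taylor north (zonal_point t) un (unit_sphere_zonal_point t).
  by rewrite dotp_north_zonal_point ct; apply.
Qed.

End Profile.
End Kernel.

(** * The eigenfunctions of the interaction operator *)

Theorem theorem8 (R : realType) (K : 'cV[R]_3 -> 'cV[R]_3 -> R) (a : nat -> R)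
  (K_cont_r : forall p, unit_sphere p -> {within unit_sphere, continuous (fun q => K p q)})
  (K_cont_l : forall q, unit_sphere q -> {within unit_sphere, continuous (fun p => K p q)})
  (K_sym : forall p q, unit_sphere p -> unit_sphere q -> K p q = K q p)
  (K_inv : forall (M : 'M[R]_3) p q, is_SO3 M -> unit_sphere p -> unit_sphere q ->
     K p q = K (M *m q) (M *m p))
  (K_taylor : forall p q, unit_sphere p -> unit_sphere q -> `|dotp p q| < 1 ->
     series (fun r => a r * dotp p q ^+ r) @ \oo --> K p q)
  (a_summable :
     (\sum_(0 <= l <oo) \sum_(l <= r <oo | ~~ odd (r - l)) `|summability_term a l r|%:E
        < +oo)%E) :
  (exists k : R -> R,
     forall p q, unit_sphere p -> unit_sphere q -> K p q = k (dotp p q)) /\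
  (forall k : R -> R,
     (forall p q, unit_sphere p -> unit_sphere q -> K p q = k (dotp p q)) ->
     forall s : nat,
       cvgn (series (mu_term a s)) /\
       forall n : int, - s%:Z <= n <= s%:Z ->
         is_eigenfunction (interaction_op k) (sph_harm s n) (mu_eigen a s)).
Proof.
split; first exact: (kernel_zonal K a K_cont_r K_taylor).
move=> k Kk s; have [M HM] := mu_term_bounded a s a_summable.
split; first exact: cvg_series_mu_term HM.
move=> n hn; have [c c0 hY] := @sph_harm_solid R s n hn.
have c0' : (c%:C)%C != 0 :> R[i] by rewrite eq_complex /= negb_and c0.
have [kc [ckc kkc kc_taylor]] := kernel_profile K a K_cont_r K_taylor k Kk.
split.
  have [q uq q0] := @solid_harmonic_neq0 R s (absz (s%:Z + n)) ltac:(lia).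
  by exists q; rewrite // hY // mulf_neq0.
move=> p up; rewrite /interaction_op hY // mulrCA.
rewrite -(funk_hecke_solid a kc s _ M p up ckc kc_taylor HM).
rewrite -sphere_integralCZ; last first.
  apply: continuousCM; last exact: continuousC_solid_harmonic.
  by apply: continuousC_real; apply: continuous_fun_comp => //; exact: continuous_dotp.
by apply: eq_sphere_integralC => q uq; rewrite hY // kkc // mulrCA.
Qed.
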